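(* Let $G$ be a word-hyperbolic group, and let $H\le G$ be a finitely generated word-hyperbolic subgroup. Suppose that the inclusion $i:H\hookrightarrow G$ admits a Cannon–Thurston map $\partial i:\partial H\to\partial G$. Let $\theta>0$ be a common admissible exponent for the logarithmic metrics $d^H_{e,\theta}$ on $\partial H$ and $d^G_{e,\theta}$ on $\partial G$. Then the following are equivalent: (1) $H$ is quasiconvex in $G$. (2) The Cannon–Thurston map $\partial i:(\partial H,d^H_{e,\theta})\to(\partial G,d^G_{e,\theta})$ is bi-Lipschitz onto its image. (3) The Cannon–Thurston map $\partial i:\partial H\to\partial G$ is injective.
   Context: Subgroups. $H\le G$ is quasiconvex if, for a finite generating set $S$ of $G$, there is $R\ge0$ such that every geodesic of the Cayley graph $\Gamma(G,S)$ with endpoints in $H$ lies in the $R$-neighborhood of $H$ (independent of $S$). A Cannon–Thurston map for $i:H\hookrightarrow G$ is the boundary restriction $\partial i:\partial H\to\partial G$ of a continuous map $H\cup\partial H\to G\cup\partial G$ (Gromov compactifications) whose restriction to $H$ is the inclusion. A map $f$ is bi-Lipschitz onto its image if $L^{-1}d(x,x')\le d(f(x),f(x'))\le L\,d(x,x')$ for some $L\ge1$. For a hyperbolic group, the boundary and the logarithmic metric are those of its Cayley graph $X$ with respect to a finite generating set, with basepoint $o=e$; a sublinear function $\kappa$ (below) is fixed. The following is for a proper geodesic hyperbolic space $X$ with basepoint $o$. $A\asymp B$ means $c^{-1}B\le A\le cB$ with $c\ge1$ independent of the boundary points. Hyperbolic spaces and boundary. $(x\mid y)_p=\frac12(d(x,p)+d(y,p)-d(x,y))$.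 $X$ is $\delta$-hyperbolic if $(x\mid z)_p\ge\min\{(x\mid y)_p,(y\mid z)_p\}-\delta$ for all points; hyperbolic means this for some $\delta\ge 0$ (fixed). A $(q,Q)$-quasi-geodesic ($q\ge1,Q\ge0$) is a continuous map $\beta:I\to X$, $I\subseteq\mathbb R$ an interval, with $\frac1q|s-t|-Q\le d(\beta(s),\beta(t))\le q|s-t|+Q$. All quasi-geodesic rays ($I=[0,\infty)$) start at $o$. The visual boundary $\partial_\infty X$ is the set of quasi-geodesic rays from $o$ modulo finite Hausdorff distance of images; every class contains a geodesic ray. Sublinear Morse boundary. A sublinear function is $\kappa:[0,\infty)\to[1,\infty)$, increasing (non-strictly), concave, $\kappa(r)/r\to0$ as $r\to\infty$. Write $\|x\|=d(o,x)$. For closed $Z\subseteq X$, $\mathcal N_\kappa(Z,n)=\{x: d(x,Z)\le n\,\kappa(\|x\|)\}$. For a quasi-geodesic ray $\beta$ and $r>0$, $t_r=\min\{t:\|\beta(t)\|=r\}$, $\beta_r=\beta(t_r)$, $\beta|_r=\beta([0,t_r])$. A closed set $Z$ is $\kappa$-Morse if there is a proper function $m_Z:[1,\infty)\times[0,\infty)\to[0,\infty)$ such that every $(q,Q)$-quasi-geodesic segment with endpoints on $Z$ lies in $\mathcal N_\kappa(Z,m_Z(q,Q))$. $\partial_\kappa X$ is the set of quasi-geodesic rays from $o$ with $\kappa$-Morse image, modulo $\alpha\sim\beta\iff d(\alpha_r,\beta_r)/r\to0$, with the topology generated by the sets $\mathcal U_\kappa$ below. For hyperbolic $X$, sending the class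 of a geodesic ray from $o$ in $\partial_\infty X$ to its class in $\partial_\kappa X$ is a well-defined homeomorphism; the two boundaries are identified and denoted $\partial X$. Fellow-traveling radius. Fix $H(\delta,q,Q)$, depending only on $\delta,q,Q$ (Morse lemma; not to be confused with the subgroup), such that every $(q,Q)$-quasi-geodesic segment with endpoints on a geodesic lies in the $H(\delta,q,Q)$-neighborhood of it, and every $(q,Q)$-quasi-geodesic ray from $o$ lies in the $H(\delta,q,Q)$-neighborhood of any geodesic ray from $o$ representing the same boundary point. Put $M(q,Q)=\max\{q,Q,H(\delta,3q,3Q),3H(\delta,q,Q)+30\delta\}$. For a geodesic ray $\alpha_0$ from $o$ and $r>0$, $\mathcal U_\kappa(\alpha_0,r)$ is the set of boundary points $b$ such that every $(q,Q)$-quasi-geodesic ray $\beta\in b$ with $M(q,Q)<\frac{r}{24\kappa(r)}$ satisfies $\beta|_r\subseteq\mathcal N_\kappa(\alpha_0,M(q,Q))$. Fix for each boundary point a geodesic representative from $o$. For distinct $a,b$ with representatives $\alpha_0,\beta_0$, $r_o(a,b)=\min\{\sup\{r>0:a\in\mathcal U_\kappa(\beta_0,r)\},\ \sup\{r>0:b\in\mathcal U_\kappa(\alpha_0,r)\}\}$ with $\sup\emptyset=0$; $r_o(a,a)=\infty$. Logarithmic metrics (base $2$). Let $\rho(a,a)=0$; for $a\ne b$ let $\rho(a,b)=1$ if $r_o(a,b)<2$ and $\rho(a,b)=2^{-\lfloor\log_2 r_o(a,b)\rfloor+1}$ if $r_o(a,b)\ge2$. An exponent $\theta$ is admissible if $0<\theta\le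 1/6$. A logarithmic metric $d^{X}_{o,\theta}$ is a metric on $\partial X$ with $d^X_{o,\theta}\asymp\rho^\theta$ (equivalently $\asymp(1+r_o)^{-\theta}$); such metrics exist for admissible $\theta$ and induce the topology of $\partial X$. *)

(* Defs.v *)
From HB Require Import structures.
From mathcomp Require Import all_boot all_order all_algebra.
From mathcomp Require Import all_classical all_reals all_analysis.

Set Implicit Arguments.
Unset Strict Implicit.
Unset Printing Implicit Defensive.

Import Order.TTheory GRing.Theory Num.Theory.
Import numFieldNormedType.Exports.

Local Open Scope classical_set_scope.
Local Open Scope ring_scope.

Definition letter (G : groupType) (S : seq G) (x : G) : bool :=
  (x \in S) || (x^-1%g \in S).

Record fin_gen_set (G : groupType) := FinGenSet {
  gens :> seq G;
  gensP : forall g : G, exists2 w : seq G,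
    all (letter gens) w & g = (\prod_(x <- w) x)%g
}.

(* The geometric realization of the Cayley graph, in barycentric coordinates: a
   point is a function on the vertex set of the form (1 - t) 1_g + t 1_h, where
   0 <= t <= 1 and g, h are equal or span an edge.  Loops and multiple edges
   of the labelled graph are thus ignored.  The distance is the path metric in
   which every edge has length 1: the infimum of the lengths of the finite
   chains of points in which two consecutive points lie on a common edge. *)

Section CayleyGraph.
Variables (R : realType) (G : groupType) (S : fin_gen_set G).

Definition adjeq (g h : G) : Prop := g = h \/ letter S (g^-1 * h)%g.

Definition bary (g h : G) (t : R) : G -> R :=
  fun v => (1 - t) * (v == g)%:R + t * (v == h)%:R.

Definition on_edge (g h : G) (x : G -> R) : Prop :=
  exists2 t : R, 0 <= t <= 1 & x = bary g h t.

Record cayley := Cayley {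
  weight :> G -> R;
  weightP : exists g h, adjeq g h /\ on_edge g h weight
}.

Lemma cayley_eq (x y : cayley) : weight x = weight y -> x = y.
Proof.
case: x y => [x px] [y py] /= xy; rewrite xy in px *.
by rewrite (Prop_irrelevance px py).
Qed.

HB.instance Definition _ := gen_eqMixin cayley.
HB.instance Definition _ := gen_choiceMixin cayley.

Lemma vertex_subproof (g : G) : exists g1 g2 : G,
  adjeq g1 g2 /\ on_edge g1 g2 (fun v => (v == g)%:R).
Proof.
exists g, g; split; first by left.
exists 0; first by rewrite lexx ler01.
by apply/funext => v; rewrite /bary subr0 mul1r mul0r addr0.
Qed.

Definition vertex (g : G) : cayley := Cayley (vertex_subproof g).

Definition segment_length (x y : cayley) (l : R) : Prop :=
  exists g h, [/\ adjeq g h, on_edge g h x, on_edge g h y & l = `|x g - y g|].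

Inductive chain_length : cayley -> cayley -> R -> Prop :=
| chain_nil x : chain_length x x 0
| chain_cons x y z l m : segment_length x y l -> chain_length y z m ->
    chain_length x z (l + m).

Definition cayley_dist (x y : cayley) : R := inf [set l | chain_length x y l].

Lemma chain_cat x y z l m :
  chain_length x y l -> chain_length y z m -> chain_length x z (l + m).
Proof.
move=> xy; elim: xy m => [u m|u v w a b uv vw IH m wz]; first by rewrite add0r.
by rewrite -addrA; apply: (chain_cons uv); apply: IH.
Qed.

Lemma segment_sym x y l : segment_length x y l -> segment_length y x l.
Proof. by move=> [g [h [gh xe ye ->]]]; exists g, h; split=> //; rewrite distrC. Qed.

Lemma chain1 x y l : segment_length x y l -> chain_length x y l.
Proof. by move=> xy; rewrite -(addr0 l); apply: chain_cons xy (chain_nil _). Qed.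

Lemma chain_sym x y l : chain_length x y l -> chain_length y x l.
Proof.
elim=> [u|u v w a b uv vw IH]; first exact: chain_nil.
by rewrite addrC; apply: chain_cat IH (chain1 (segment_sym uv)).
Qed.

Lemma segment_weight x y l (v : G) : segment_length x y l -> `|x v - y v| <= l.
Proof.
move=> [g [h [_ [t _ ->] [u _ ->] ->]]]; rewrite /bary eqxx.
have [<-|gh] := eqVneq g h.
  by rewrite -!mulrDl !subrK subrr normr0.
rewrite !mulr1 !mulr0 !addr0.
have [->|vg] := eqVneq v g; first by rewrite (negbTE gh) !mulr1 !mulr0 !addr0.
rewrite !mulr0 !add0r.
have -> : 1 - t - (1 - u) = - (t - u) by rewrite !opprB addrC subrKA.
rewrite normrN.
by case: (v == h); rewrite ?mulr1 // !mulr0 subr0 normr0.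
Qed.

Lemma chain_weight x y l (v : G) : chain_length x y l -> `|x v - y v| <= l.
Proof.
elim=> [u|a b c l1 l2 ab bc IH]; first by rewrite subrr normr0.
apply: le_trans (lerD (segment_weight v ab) IH).
by rewrite -[a v - c v](subrKA (b v)) ler_normD.
Qed.

Lemma edge_chain g h : adjeq g h -> exists l, chain_length (vertex g) (vertex h) l.
Proof.
move=> gh; eexists; apply: chain1; exists g, h; split=> //.
- exists 0; first by rewrite lexx ler01.
  by apply/funext => v; rewrite /bary subr0 mul1r mul0r addr0.
- exists 1; first by rewrite lexx ler01.
  by apply/funext => v; rewrite /bary subrr mul1r mul0r add0r.
Qed.

Lemma vertex_chain g h : exists l, chain_length (vertex g) (vertex h) l.
Proof.
have [w wS e] := gensP S (g^-1 * h)%g.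
have -> : h = (g * \prod_(x <- w) x)%g by rewrite -e mulgA mulgV mul1g.
elim: w wS g {e} => [_ g|s w IH /= /andP[sS wS] g].
  by rewrite big_nil mulg1; exists 0; apply: chain_nil.
have [l1 c1] : exists l, chain_length (vertex g) (vertex (g * s)%g) l.
  by apply: edge_chain; right; rewrite mulgA mulVg mul1g.
have [l2 c2] := IH wS (g * s)%g.
by rewrite big_cons mulgA; exists (l1 + l2); apply: chain_cat c1 c2.
Qed.

Lemma to_vertex x : exists g l, chain_length x (vertex g) l.
Proof.
have [g [h [gh xe]]] := weightP x.
exists g; eexists; apply: chain1; exists g, h; split=> //.
exists 0; first by rewrite lexx ler01.
by apply/funext => v; rewrite /bary subr0 mul1r mul0r addr0.
Qed.

Lemma chain_nonempty x y : [set l | chain_length x y l] !=set0.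
Proof.
have [g [l1 c1]] := to_vertex x; have [h [l2 c2]] := to_vertex y.
have [l3 c3] := vertex_chain g h.
by exists (l1 + (l3 + l2)); apply: chain_cat c1 (chain_cat c3 (chain_sym c2)).
Qed.

Lemma chain_has_inf x y : has_inf [set l | chain_length x y l].
Proof.
split; first exact: chain_nonempty.
by exists 0 => l /(chain_weight 1%g); apply: le_trans.
Qed.

Lemma cayley_distxx x : cayley_dist x x = 0.
Proof.
apply/eqP; rewrite eq_le; apply/andP; split.
  by apply: ge_inf (chain_nil x); case: (chain_has_inf x x).
apply: lb_le_inf (chain_nonempty x x) _ => l /(chain_weight 1%g).
exact: le_trans.
Qed.

Lemma cayley_dist_eq0 x y : cayley_dist x y = 0 -> x = y.
Proof.
move=> xy0; apply/cayley_eq/funext => v; apply/eqP; rewrite -subr_eq0 -normr_le0.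
rewrite -xy0; apply: lb_le_inf (chain_nonempty x y) _ => l.
exact: chain_weight.
Qed.

Lemma cayley_dist_sym x y : cayley_dist x y = cayley_dist y x.
Proof.
by congr inf; apply/seteqP; split=> l; apply: chain_sym.
Qed.

Lemma cayley_dist_triangle y x z :
  cayley_dist x z <= cayley_dist x y + cayley_dist y z.
Proof.
rewrite -lerBlDr; apply: lb_le_inf (chain_nonempty x y) _ => l xy.
rewrite lerBlDr -lerBlDl; apply: lb_le_inf (chain_nonempty y z) _ => m yz.
rewrite lerBlDl; apply: ge_inf (chain_cat xy yz).
by case: (chain_has_inf x z).
Qed.

HB.instance Definition _ := isMetric.Build R cayley
  cayley_distxx cayley_dist_eq0 cayley_dist_sym cayley_dist_triangle.

End CayleyGraph.

Arguments vertex {R G} S g.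

Section MetricSpace.
Variables (R : realType) (X : metricType R).
Implicit Types (x y z p o : X) (Z : set X) (I : set R) (alpha beta : R -> X).

Definition gromov_product p x y : R :=
  (mdist x p + mdist y p - mdist x y) / 2.

Definition gromov_hyperbolic (delta : R) : Prop :=
  forall p x y z,
    Num.min (gromov_product p x y) (gromov_product p y z) - delta
      <= gromov_product p x z.

Definition dist_set x Z : R := inf [set mdist x z | z in Z].

Definition nbhd Z (r : R) : set X := [set x | dist_set x Z <= r].

Definition half_line : set R := `[0, +oo[.

(* Maps are total on R; only their restriction to I matters. *)
Definition geodesic I beta : Prop :=
  forall s t, I s -> I t -> mdist (beta s) (beta t) = `|s - t|.

Definition quasi_geodesic (q Q : R) I beta : Prop :=
  [/\ 1 <= q, 0 <= Q, {within I, continuous beta} &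
      forall s t, I s -> I t ->
        `|s - t| / q - Q <= mdist (beta s) (beta t) <= q * `|s - t| + Q].

Definition geodesic_ray o beta : Prop := geodesic half_line beta /\ beta 0 = o.

Definition quasi_geodesic_ray_with (q Q : R) o beta : Prop :=
  quasi_geodesic q Q half_line beta /\ beta 0 = o.

Definition quasi_geodesic_ray o beta : Prop :=
  exists q Q : R, quasi_geodesic_ray_with q Q o beta.

(* Finite Hausdorff distance between the images. *)
Definition asymptotic alpha beta : Prop :=
  exists D : R,
    alpha @` half_line `<=` nbhd (beta @` half_line) D /\
    beta @` half_line `<=` nbhd (alpha @` half_line) D.

(* A boundary point is the set of all quasi-geodesic rays representing it. *)
Record boundary (o : X) := Boundary {
  rays_of : set (R -> X);
  rays_ofP : exists2 alpha, quasi_geodesic_ray o alpha &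
    rays_of = [set beta | quasi_geodesic_ray o beta /\ asymptotic alpha beta]
}.

(* h is the radius function (q, Q) |-> h q Q of the Morse lemma for X. *)
Definition morse_radius (o : X) (h : R -> R -> R) : Prop :=
  (forall (q Q : R) (J : set R) gamma (a b : R) beta,
     is_interval J -> geodesic J gamma ->
     a <= b -> quasi_geodesic q Q `[a, b] beta ->
     (gamma @` J) (beta a) -> (gamma @` J) (beta b) ->
     beta @` `[a, b] `<=` nbhd (gamma @` J) (h q Q)) /\
  (forall (q Q : R) (b : boundary o) alpha beta,
     quasi_geodesic_ray_with q Q o beta -> rays_of b beta ->
     geodesic_ray o alpha -> rays_of b alpha ->
     beta @` half_line `<=` nbhd (alpha @` half_line) (h q Q)).

End MetricSpace.

Arguments half_line {R}.

Definition sublinear (R : realType) (kappa : R -> R) : Prop :=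
  [/\ forall r, 0 <= r -> 1 <= kappa r,
      forall r s, 0 <= r -> r <= s -> kappa r <= kappa s,
      forall r s t, 0 <= r -> 0 <= s -> 0 <= t <= 1 ->
        t * kappa r + (1 - t) * kappa s <= kappa (t * r + (1 - t) * s) &
      kappa r / r @[r --> +oo] --> (0 : R)].

Section KappaBoundary.
Variables (R : realType) (X : metricType R) (o : X) (kappa : R -> R).
Implicit Types (Z : set X) (alpha beta : R -> X).

Definition kappa_nbhd Z (n : R) : set X :=
  [set x | dist_set x Z <= n * kappa (mdist o x)].

Definition hit_time beta (r : R) : R :=
  inf [set t | 0 <= t /\ mdist o (beta t) = r].

Definition hit_point beta (r : R) : X := beta (hit_time beta r).

Definition initial_part beta (r : R) : set X := beta @` `[0, hit_time beta r].

(* Proper: the preimages of bounded sets are bounded. *)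
Definition proper_morse_function (m : R -> R -> R) : Prop :=
  (forall q Q, 1 <= q -> 0 <= Q -> 0 <= m q Q) /\
  (forall C : R, exists B : R, forall q Q, 1 <= q -> 0 <= Q ->
     m q Q <= C -> q <= B /\ Q <= B).

Definition kappa_morse Z : Prop :=
  closed Z /\
  exists2 m, proper_morse_function m &
    forall (q Q a b : R) beta, a <= b -> quasi_geodesic q Q `[a, b] beta ->
      Z (beta a) -> Z (beta b) -> beta @` `[a, b] `<=` kappa_nbhd Z (m q Q).

Definition kappa_ray beta : Prop :=
  quasi_geodesic_ray o beta /\ kappa_morse (beta @` half_line).

Definition sublinearly_tracks alpha beta : Prop :=
  mdist (hit_point alpha r) (hit_point beta r) / r @[r --> +oo] --> (0 : R).

(* The point of the kappa-boundary identified with a point b of the visual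
   boundary: the kappa-class of the geodesic rays of b. *)
Definition kappa_class (b : boundary o) : set (R -> X) :=
  [set beta | kappa_ray beta /\
     exists alpha, [/\ rays_of b alpha, geodesic_ray o alpha, kappa_ray alpha &
                       sublinearly_tracks alpha beta]].

Variables (delta : R) (h : R -> R -> R -> R).

Definition radius_bound (q Q : R) : R :=
  Num.max (Num.max q Q)
    (Num.max (h delta (3 * q) (3 * Q)) (3 * h delta q Q + 30 * delta)).

Definition U_kappa (alpha0 : R -> X) (r : R) : set (boundary o) :=
  [set b | forall (q Q : R) beta,
     kappa_class b beta -> quasi_geodesic_ray_with q Q o beta ->
     radius_bound q Q < r / (24 * kappa r) ->
     initial_part beta r `<=`
       kappa_nbhd (alpha0 @` half_line) (radius_bound q Q)].

Definition geodesic_representatives (rep : boundary o -> R -> X) : Prop :=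
  forall b, geodesic_ray o (rep b) /\ rays_of b (rep b).

Variable rep : boundary o -> R -> X.

(* Adjoining 0 to the set of radii implements the convention sup set0 = 0. *)
Definition sup_radius (a b : boundary o) : \bar R :=
  ereal_sup [set r%:E | r in [set r | r = 0 \/ 0 < r /\ U_kappa (rep b) r a]].

Definition fellow_radius (a b : boundary o) : \bar R :=
  if `[< a = b >] then +oo%E else Order.min (sup_radius a b) (sup_radius b a).

(* fellow_radius a b is finite for a <> b: when U_kappa (rep b) r a holds for
   arbitrarily large r, the geodesic rays of a sublinearly track those of b. *)
Definition log_rho (a b : boundary o) : R :=
  if `[< a = b >] then 0 else
  let r := fine (fellow_radius a b) in
  if r < 2 then 1 else 2 ^ (- Num.floor (ln r / ln 2) + 1).

Definition admissible_exponent (theta : R) : Prop := 0 < theta <= 1 / 6.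

Definition is_metric (T : Type) (d : T -> T -> R) : Prop :=
  [/\ forall a b, 0 <= d a b,
      forall a b, d a b = 0 <-> a = b,
      forall a b, d a b = d b a &
      forall a b c, d a c <= d a b + d b c].

Definition log_metric (theta : R) (d : boundary o -> boundary o -> R) : Prop :=
  is_metric d /\
  exists2 c : R, 1 <= c &
    forall a b, c^-1 * (log_rho a b `^ theta) <= d a b <= c * (log_rho a b `^ theta).

End KappaBoundary.

Definition bilipschitz_onto_image (R : realType) (A B : Type)
    (dA : A -> A -> R) (dB : B -> B -> R) (f : A -> B) : Prop :=
  exists2 L : R, 1 <= L &
    forall x y, L^-1 * dA x y <= dB (f x) (f y) <= L * dA x y.

Definition group_boundary (R : realType) (G : groupType) (S : fin_gen_set G) :=
  boundary (vertex S 1%g : cayley R S).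

Section GromovCompactification.
Variables (R : realType) (G : groupType) (S : fin_gen_set G).

Inductive gromov_compactification : Type :=
| GroupPoint of G
| BoundaryPoint of group_boundary R S.

HB.instance Definition _ := gen_eqMixin gromov_compactification.
HB.instance Definition _ := gen_choiceMixin gromov_compactification.

Definition representatives (y : gromov_compactification) : set (R -> cayley R S) :=
  match y with
  | GroupPoint g => [set cst (vertex S g)]
  | BoundaryPoint b => rays_of b
  end.

(* sup, over the representatives alpha of y and beta of z, of
   liminf_(s, t -> +oo) (alpha s | beta t)_e. *)
Definition extended_gromov_product (y z : gromov_compactification) : \bar R :=
  ereal_sup [set N%:E | N in [set N : R | exists alpha beta (T : R),
    [/\ representatives y alpha, representatives z beta &
        forall s t, T <= s -> T <= t ->
          N <= gromov_product (vertex S 1%g) (alpha s) (beta t)]]].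

(* The group is discrete and open, and the sets {y | (y | b) > N} form a
   neighbourhood base at a boundary point b. *)
Definition compactification_open (U : set gromov_compactification) : Prop :=
  forall b, U (BoundaryPoint b) ->
    exists N : R, forall y,
      (N%:E < extended_gromov_product y (BoundaryPoint b))%E -> U y.

Lemma compactification_openT : compactification_open setT.
Proof. by move=> b _; exists 0. Qed.

Lemma compactification_openI : setI_closed compactification_open.
Proof.
move=> U V oU oV b [Ub Vb].
have [N NU] := oU _ Ub; have [M MV] := oV _ Vb.
exists (Num.max N M) => y; rewrite EFin_max gt_max => /andP[Ny My].
by split; [apply: NU|apply: MV].
Qed.

Lemma compactification_open_bigU (I : Type) (f : I -> set gromov_compactification) :
  (forall i, compactification_open (f i)) ->
  compactification_open (\bigcup_i f i).
Proof.
move=> of_ b [i _ fib]; have [N Nf] := of_ i b fib.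
by exists N => y /Nf fiy; exists i.
Qed.

HB.instance Definition _ := isOpenTopological.Build gromov_compactification
  compactification_openT compactification_openI compactification_open_bigU.

Definition quasiconvex_wrt (A : set G) : Prop :=
  exists2 r : R, 0 <= r &
    forall (a b : R) (gamma : R -> cayley R S), a <= b ->
      geodesic `[a, b] gamma ->
      (vertex S @` A) (gamma a) -> (vertex S @` A) (gamma b) ->
      gamma @` `[a, b] `<=` nbhd (vertex S @` A) r.

End GromovCompactification.

(* The choice of S is immaterial. *)
Definition quasiconvex (R : realType) (G : groupType) (A : set G) : Prop :=
  exists S : fin_gen_set G, @quasiconvex_wrt R G S A.

Definition cannon_thurston (R : realType) (G H : groupType)
    (SG : fin_gen_set G) (SH : fin_gen_set H) (i : H -> G)
    (f : group_boundary R SH -> group_boundary R SG) : Prop :=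
  exists F : gromov_compactification R SH -> gromov_compactification R SG,
    [/\ continuous F,
        forall x, F (GroupPoint R SH x) = GroupPoint R SG (i x) &
        forall b, F (BoundaryPoint b) = BoundaryPoint (f b)].

(* Main.v *)
Require Import Defs.
From HB Require Import structures.
From mathcomp Require Import all_boot all_order all_algebra.
From mathcomp Require Import all_classical all_reals all_analysis.
From mathcomp Require Import lra zify.

Set Implicit Arguments.
Unset Strict Implicit.
Unset Printing Implicit Defensive.

Import Order.TTheory GRing.Theory Num.Theory.
Import numFieldNormedType.Exports.

Local Open Scope classical_set_scope.
Local Open Scope ring_scope.

(* In a hyperbolic space the fellow-traveling radius of two distinct boundary
   points is comparable, up to additive and multiplicative constants, with the
   supremum of the Gromov products along their geodesic representatives: the
   Morse lemma gives the lower bound, and testing the definition on the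
   representatives themselves gives the upper bound, since [kappa] is sublinear.
   So a logarithmic metric is, up to a factor, a power of the inverse of
   1 + (a | b).

   If H is quasiconvex, it is quasi-isometrically embedded in G; by the Morse
   lemma in G its geodesics are mapped close to geodesics, hence the Gromov
   products of H and G are linearly comparable on H.  As the Cannon-Thurston map
   is the limit of the inclusion, this passes to the boundaries and gives the
   bi-Lipschitz property.

   If H is not quasiconvex, translation yields x_n, y_n in H such that 1 lies on
   an H-geodesic from x_n to y_n while (x_n | y_n) is unbounded in G.  By
   Konig's lemma subsequences of x_n and y_n converge to boundary points of H,
   which are distinct but have the same image in the boundary of G. *)

(** * Distances and visual boundaries *)

(** Logarithmic metrics suit the problem because they decay like a power of [1 + (a | b)] and not
    exponentially. A quasi-isometric embedding distorts Gromov products linearly; here this costs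
    only a bounded factor, whereas for visual metrics it would give just a Holder estimate. A
    bi-Lipschitz map between metrics is injective, so the cycle (1), (2), (3), (1) closes with the
    passage from injectivity to quasiconvexity.

    Continuity of the Cannon-Thurston map enters only through [cannon_thurston_product], a statement
    about one boundary point at a time. This control is not uniform in the boundary point, so every
    uniform constant has to come from inequalities inside the two groups, and the map serves only to
    pass to the limit. *)

Section Distances.
Variables (R : realType) (X : metricType R).
Implicit Types (x y z p : X) (Z : set X).

Lemma dist_set_has_inf x Z : Z !=set0 -> has_inf [set mdist x z | z in Z].
Proof.
move=> [z Zz]; split; first by exists (mdist x z), z.
by exists 0 => _ [u _ <-]; apply: mdist_ge0.
Qed.

Lemma dist_set_le x z Z r : Z z -> mdist x z <= r -> dist_set x Z <= r.
Proof.
move=> Zz; apply: le_trans; apply: ge_inf; last by exists z.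
by case: (dist_set_has_inf x (ex_intro _ z Zz)).
Qed.

Lemma dist_set_lt x Z r : Z !=set0 -> dist_set x Z < r ->
  exists2 z, Z z & mdist x z < r.
Proof.
move=> Z0 /(inf_lt (dist_set_has_inf x Z0).1) [_ [z Zz <-] zr].
by exists z.
Qed.

Lemma dist_set_ge0 x Z : Z !=set0 -> 0 <= dist_set x Z.
Proof.
move=> Z0; apply: lb_le_inf; first by case: (dist_set_has_inf x Z0).
by move=> _ [u _ <-]; apply: mdist_ge0.
Qed.

(** The infimum in [dist_set] need not be attained, whence the slack [e]. *)
Lemma nbhdP Z r x : Z !=set0 -> nbhd Z r x ->
  forall e, 0 < e -> exists2 z, Z z & mdist x z < r + e.
Proof.
move=> Z0 xr e e0; apply: dist_set_lt => //.
by apply: (le_lt_trans xr); rewrite ltrDl.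
Qed.

Lemma gromov_productC p x y : gromov_product p x y = gromov_product p y x.
Proof. by rewrite /gromov_product (metric_sym x y) (addrC (mdist x p)). Qed.

Lemma gromov_product_ge0 p x y : 0 <= gromov_product p x y.
Proof.
have := metric_triangle x p y; rewrite (metric_sym p y) /gromov_product; lra.
Qed.

Lemma gromov_product_le_dist p x y : gromov_product p x y <= mdist x p.
Proof.
have := metric_triangle y x p; rewrite (metric_sym y x) /gromov_product; lra.
Qed.

Lemma gromov_product_base p q x y :
  gromov_product p x y <= gromov_product q x y + mdist p q.
Proof.
have := metric_triangle x q p; have := metric_triangle y q p.
rewrite /gromov_product (metric_sym q p); lra.
Qed.

Lemma gromov_product_near p x x' y :
  gromov_product p x y <= gromov_product p x' y + mdist x x'.
Proof.
have := metric_triangle x x' p; have := metric_triangle x' x y.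
rewrite /gromov_product (metric_sym x' x); lra.
Qed.

Lemma half_line0 : @half_line R 0.
Proof. by rewrite /half_line /= in_itv /= lexx. Qed.

Lemma half_lineP (t : R) : half_line t <-> 0 <= t.
Proof. by rewrite /half_line /= in_itv /= andbT. Qed.

Lemma half_line_image_neq0 (alpha : R -> X) : alpha @` half_line !=set0.
Proof. by exists (alpha 0), 0 => //; apply: half_line0. Qed.


Lemma lipschitz_within_continuous (I : set R) (q : R) (beta : R -> X) : 0 < q ->
  (forall s t, I s -> I t -> mdist (beta s) (beta t) <= q * `|s - t|) ->
  {within I, continuous beta}.
Proof.
move=> q0 lip; apply/subspace_continuousP => x Ix.
apply/metricType_numDomainType.cvgrPdist_lt => e e0.
rewrite near_withinE; near=> t => It.
apply: (le_lt_trans (lip _ _ Ix It)); rewrite mulrC -ltr_pdivlMr //.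
by near: t; apply: (@cvgr_dist_lt _ _ _ (nbhs x) _ id x) => //; apply: divr_gt0.
Unshelve. all: by end_near. Qed.

Lemma within_continuous_mdist (I : set R) (o : X) (beta : R -> X) :
  {within I, continuous beta} ->
  {within I, continuous (fun t => mdist o (beta t))}.
Proof.
move=> /subspace_continuousP cb; apply/subspace_continuousP => x Ix.
apply/cvgrPdist_lt => e e0.
have := cb x Ix; move/metricType_numDomainType.cvgrPdist_lt => /(_ e e0).
rewrite !near_withinE; apply: filterS => t xt /xt.
apply: le_lt_trans; rewrite ler_norml /from_subspace.
have := metric_triangle o (beta x) (beta t).
have := metric_triangle o (beta t) (beta x).
rewrite (metric_sym (beta t) (beta x)) => *. apply/andP; split; lra.
Qed.

End Distances.

Section Boundary.
Variables (R : realType) (X : metricType R) (o : X).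
Implicit Types (alpha beta gamma : R -> X) (a b c : boundary o).

Lemma asymptotic_near alpha beta : asymptotic alpha beta ->
  exists2 D : R, 0 <= D & forall s, 0 <= s ->
    exists2 u, 0 <= u & mdist (alpha s) (beta u) <= D.
Proof.
move=> [D [aD _]]; exists (`|D| + 1); first by rewrite addr_ge0.
move=> s /half_lineP s0.
have aDs : nbhd (beta @` half_line) D (alpha s) by apply: aD; exists s.
have [_ [u /half_lineP u0 <-] sy] := nbhdP (half_line_image_neq0 beta) aDs ltr01.
by exists u => //; have := ler_norm D; lra.
Qed.

Lemma asymptotic_sym alpha beta : asymptotic alpha beta -> asymptotic beta alpha.
Proof. by move=> [D [? ?]]; exists D. Qed.

Lemma near_asymptotic alpha beta (D E : R) :
  (forall s, 0 <= s -> exists2 u, 0 <= u & mdist (alpha s) (beta u) <= D) ->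
  (forall s, 0 <= s -> exists2 u, 0 <= u & mdist (beta s) (alpha u) <= E) ->
  asymptotic alpha beta.
Proof.
move=> ab ba; exists (Num.max D E); split => _ [s /half_lineP s0 <-].
- have [u /half_lineP u0 su] := ab s s0.
  by apply: (@dist_set_le _ _ _ (beta u)); [exists u|rewrite le_max su].
- have [u /half_lineP u0 su] := ba s s0.
  by apply: (@dist_set_le _ _ _ (alpha u)); [exists u|rewrite le_max su orbT].
Qed.

Lemma asymptotic_trans alpha beta gamma :
  asymptotic alpha beta -> asymptotic beta gamma -> asymptotic alpha gamma.
Proof.
move=> ab bc.
have [D1 _ ab1] := asymptotic_near ab; have [D2 _ bc1] := asymptotic_near bc.
have [E1 _ ba1] := asymptotic_near (asymptotic_sym ab).
have [E2 _ cb1] := asymptotic_near (asymptotic_sym bc).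
apply: (@near_asymptotic _ _ (D1 + D2) (E2 + E1)) => s s0.
- have [u u0 su] := ab1 s s0; have [v v0 uv] := bc1 u u0; exists v => //.
  by apply: (le_trans (metric_triangle _ (beta u) _)); apply: lerD.
- have [u u0 su] := cb1 s s0; have [v v0 uv] := ba1 u u0; exists v => //.
  by apply: (le_trans (metric_triangle _ (beta u) _)); apply: lerD.
Qed.

Lemma asymptotic_refl alpha : asymptotic alpha alpha.
Proof. by apply: (@near_asymptotic _ _ 0 0) => s s0; exists s; rewrite ?mdistxx. Qed.

Lemma boundary_eq a b : rays_of a = rays_of b -> a = b.
Proof.
by case: a b => [a pa] [b pb] /= ab; rewrite ab in pa *; rewrite (Prop_irrelevance pa pb).
Qed.

Lemma rays_of_qg b beta : rays_of b beta -> quasi_geodesic_ray o beta.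
Proof. by have [alpha _ ->] := rays_ofP b => -[]. Qed.

Lemma rays_of_asymptotic b alpha beta :
  rays_of b alpha -> rays_of b beta -> asymptotic alpha beta.
Proof.
have [gamma _ ->] := rays_ofP b => -[_ ga] [_ gb].
exact: asymptotic_trans (asymptotic_sym ga) gb.
Qed.

Lemma rays_of_trans b alpha beta : rays_of b alpha ->
  quasi_geodesic_ray o beta -> asymptotic alpha beta -> rays_of b beta.
Proof.
have [gamma _ ->] := rays_ofP b => -[_ ga] qb ab; split=> //.
exact: asymptotic_trans ga ab.
Qed.

Lemma boundary_eq_ray a b alpha beta : rays_of a alpha -> rays_of b beta ->
  asymptotic alpha beta -> a = b.
Proof.
move=> aa bb ab; apply: boundary_eq; apply/seteqP; split=> gamma cg.
- apply: (rays_of_trans bb (rays_of_qg cg)).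
  apply: asymptotic_trans (asymptotic_sym ab) _.
  exact: rays_of_asymptotic aa cg.
- apply: (rays_of_trans aa (rays_of_qg cg)).
  by apply: asymptotic_trans ab _; apply: rays_of_asymptotic bb cg.
Qed.

Lemma ray_boundary alpha : quasi_geodesic_ray o alpha ->
  exists b : boundary o, rays_of b alpha.
Proof.
move=> qa.
have P : exists2 alpha0, quasi_geodesic_ray o alpha0 &
    [set beta | quasi_geodesic_ray o beta /\ asymptotic alpha beta] =
    [set beta | quasi_geodesic_ray o beta /\ asymptotic alpha0 beta].
  by exists alpha.
by exists (Boundary P); split => //; apply: asymptotic_refl.
Qed.

Lemma geodesic_quasi (I : set R) alpha : geodesic I alpha -> quasi_geodesic 1 0 I alpha.
Proof.
move=> ga; split => //; last first.
  by move=> s t Is It; rewrite ga // divr1 subr0 mul1r addr0 lexx.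
by apply: (@lipschitz_within_continuous _ _ _ 1) => // s t Is It; rewrite mul1r ga.
Qed.

Lemma geodesic_ray_quasi alpha : geodesic_ray o alpha -> quasi_geodesic_ray o alpha.
Proof. by move=> [ga a0]; exists 1, 0; split => //; apply: geodesic_quasi. Qed.

Lemma geodesic_ray_dist alpha s t : geodesic_ray o alpha -> 0 <= s -> 0 <= t ->
  mdist (alpha s) (alpha t) = `|s - t|.
Proof. by move=> [ga _] /half_lineP s0 /half_lineP t0; apply: ga. Qed.

Lemma geodesic_ray_norm alpha s : geodesic_ray o alpha -> 0 <= s ->
  mdist o (alpha s) = s.
Proof.
move=> ga s0; have [_ {1}<-] := ga.
by rewrite (geodesic_ray_dist ga) // sub0r normrN ger0_norm.
Qed.

Lemma gromov_product_ray alpha s t : geodesic_ray o alpha -> 0 <= s -> s <= t ->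
  gromov_product o (alpha s) (alpha t) = s.
Proof.
move=> ga s0 st; have t0 := le_trans s0 st.
rewrite /gromov_product !(metric_sym _ o) !(geodesic_ray_norm ga) //.
rewrite (geodesic_ray_dist ga) // distrC ger0_norm ?subr_ge0 //; lra.
Qed.

(** Moving out along a ray adds exactly [t - s] to the norm and at most [t - s] to the distance to
    [y]. Hence a bound at late times holds at all earlier times. *)
Lemma gromov_product_ray_mono alpha y s t : geodesic_ray o alpha -> 0 <= s -> s <= t ->
  gromov_product o (alpha s) y <= gromov_product o (alpha t) y.
Proof.
move=> ga s0 st; have t0 := le_trans s0 st.
have := metric_triangle (alpha t) (alpha s) y.
rewrite /gromov_product !(metric_sym _ o) !(geodesic_ray_norm ga) //.
rewrite (geodesic_ray_dist ga) // ger0_norm ?subr_ge0 //; lra.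
Qed.

Lemma gromov_product_rays_mono alpha beta s t : geodesic_ray o alpha ->
  geodesic_ray o beta -> 0 <= s -> s <= t ->
  gromov_product o (alpha s) (beta s) <= gromov_product o (alpha t) (beta t).
Proof.
move=> ga gb s0 st; apply: le_trans (gromov_product_ray_mono _ ga s0 st) _.
rewrite !(gromov_productC _ (alpha t)).
exact: gromov_product_ray_mono.
Qed.

(** The point [beta s] is within [D] of some [alpha u], where [u] grows with [s]; on a single
    geodesic ray the product is the smaller of the two parameters. *)
Lemma gromov_product_rays_cvg c alpha beta (N : R) :
  rays_of c alpha -> rays_of c beta -> geodesic_ray o alpha ->
  exists2 T : R, 0 <= T & forall s t, T <= s -> T <= t ->
    N <= gromov_product o (beta s) (alpha t).
Proof.
move=> ca cb ga; have [D D0 ba] := asymptotic_near (rays_of_asymptotic cb ca).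
have [q [Q [[q1 Q0 _ bq] b0]]] := rays_of_qg cb.
have q0 : 0 < q by apply: lt_le_trans q1.
(* From [s / q - Q >= |N| + 2 * D] follows [u >= |N| + D]; replacing [beta s] by [alpha u] then
   costs another [D]. *)
exists (q * (`|N| + 2 * D + Q)).
  by rewrite mulr_ge0 ?(ltW q0) // addr_ge0 // addr_ge0 // mulr_ge0.
move=> s t Ts Tt.
have A0 : 0 <= `|N| + 2 * D + Q by rewrite addr_ge0 // addr_ge0 // mulr_ge0.
have TA : `|N| + 2 * D + Q <= q * (`|N| + 2 * D + Q) by rewrite ler_peMl.
have s0 : 0 <= s by apply: le_trans Ts; apply: le_trans TA.
have t0 : 0 <= t by apply: le_trans Tt; apply: le_trans TA.
have [u u0 su] := ba s s0.
have /andP[sl _] := bq 0 s (half_line0 R) ((half_lineP s).2 s0).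
rewrite b0 sub0r normrN ger0_norm // in sl.
have {}sl : `|N| + 2 * D + Q - Q <= mdist o (beta s).
  by apply: le_trans sl; rewrite lerD2r ler_pdivlMr // mulrC.
have uN : `|N| + D <= u.
  rewrite -(geodesic_ray_norm ga u0).
  have := metric_triangle o (alpha u) (beta s); rewrite (metric_sym (alpha u)); lra.
have := gromov_product_near o (alpha u) (beta s) (alpha t); rewrite metric_sym => gn.
have gu : `|N| + D <= gromov_product o (alpha u) (alpha t).
  have [ut|/ltW tu] := lerP u t.
    by rewrite (gromov_product_ray ga u0 ut).
  rewrite gromov_productC (gromov_product_ray ga t0 tu).
  by apply: le_trans Tt; apply: le_trans TA; lra.
have := ler_norm N; lra.
Qed.

End Boundary.

(** * The fellow-traveling radius in a hyperbolic space *)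

Section Hyperbolic.
Variables (R : realType) (X : metricType R) (o : X) (delta : R).
Hypotheses (delta_ge0 : 0 <= delta) (hypX : gromov_hyperbolic X delta).
Implicit Types (N q Q r s t : R) (p x y z w : X).
Implicit Types (alpha beta gamma : R -> X) (a b c : boundary o).

Lemma gromov_product_trans p x y z N :
  N <= gromov_product p x y -> N <= gromov_product p y z ->
  N - delta <= gromov_product p x z.
Proof.
move=> xy yz; apply: le_trans (hypX p x y z).
by rewrite lerD2r le_min xy yz.
Qed.

Lemma gromov_product_trans4 p x y z w N :
  N <= gromov_product p x y -> N <= gromov_product p y z ->
  N <= gromov_product p z w -> N - 2 * delta <= gromov_product p x w.
Proof.
move=> xy yz zw.
have xz := gromov_product_trans xy yz.
have d0 := delta_ge0; have zw' : N - delta <= gromov_product p z w by lra.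
have := gromov_product_trans xz zw'; lra.
Qed.

Lemma rays_fellow_travel alpha beta s s' t :
  geodesic_ray o alpha -> geodesic_ray o beta -> 0 <= t -> 0 <= s -> 0 <= s' ->
  t <= gromov_product o (alpha s) (beta s') ->
  mdist (alpha t) (beta t) <= 4 * delta.
Proof.
move=> ga gb t0 s0 s'0 tg.
have ts : t <= s.
  rewrite -(geodesic_ray_norm ga s0) metric_sym.
  exact: le_trans tg (gromov_product_le_dist _ _ _).
have ts' : t <= s'.
  rewrite -(geodesic_ray_norm gb s'0) metric_sym.
  by apply: le_trans tg _; rewrite gromov_productC; apply: gromov_product_le_dist.
have H1 : t <= gromov_product o (alpha t) (alpha s).
  by rewrite (gromov_product_ray ga t0 ts).
have H3 : t <= gromov_product o (beta s') (beta t).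
  by rewrite gromov_productC (gromov_product_ray gb t0 ts').
(* The result is [(alpha t | beta t) >= t - 2 * delta]; both points have norm [t], so their distance
   is at most [4 * delta]. *)
have := gromov_product_trans4 H1 tg H3.
rewrite /gromov_product !(metric_sym _ o) !(geodesic_ray_norm ga) //.
by rewrite !(geodesic_ray_norm gb) //; lra.
Qed.

(** Unbounded products make the two rays fellow-travel at every time. This is the test for equality
    of boundary points, applied later to the images under [di] as well. *)
Lemma boundary_eq_gromov_product a b alpha beta :
  rays_of a alpha -> rays_of b beta ->
  geodesic_ray o alpha -> geodesic_ray o beta ->
  (forall N : R, exists s s', [/\ 0 <= s, 0 <= s' &
     N <= gromov_product o (alpha s) (beta s')]) -> a = b.
Proof.
move=> aa bb ga gb gp; apply: (boundary_eq_ray aa bb).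
apply: (@near_asymptotic _ _ _ _ (4 * delta) (4 * delta)) => t t0.
  exists t => //; have [s [s' [s0 s'0 tg]]] := gp t.
  exact: rays_fellow_travel ga gb t0 s0 s'0 tg.
exists t => //; have [s [s' [s0 s'0 tg]]] := gp t.
by rewrite metric_sym; apply: rays_fellow_travel ga gb t0 s0 s'0 tg.
Qed.

Variable (kappa : R -> R).
Hypothesis kappaP : sublinear kappa.

Lemma kappa_ge1 r : 0 <= r -> 1 <= kappa r.
Proof. by case: kappaP => + _ _ _; apply. Qed.

Lemma geodesic_ray_closed alpha : geodesic_ray o alpha ->
  closed (alpha @` half_line).
Proof.
(* The only candidate parameter for a limit point [p] is its norm. *)
move=> ga p clp; exists (mdist o p); first exact/half_lineP/mdist_ge0.
apply/mdist_positivity/eqP; rewrite eq_le mdist_ge0 andbT.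
apply/ler_addgt0Pl => e e0; rewrite addr0.
have e20 : 0 < e / 2 by apply: divr_gt0.
have : nbhs p (ball p (e / 2)) by apply: nbhsx_ballx.
move=> /clp[_ [[t /half_lineP t0 <-]]]; rewrite ballEmdist /= => pt.
have at_ := geodesic_ray_dist ga (mdist_ge0 o p) t0.
have pn : `|mdist o p - t| <= e / 2.
  rewrite -{1}(geodesic_ray_norm ga t0) ler_norml.
  have := metric_triangle o p (alpha t); have := metric_triangle o (alpha t) p.
  rewrite (metric_sym (alpha t) p) => *; apply/andP; split; lra.
have := metric_triangle (alpha (mdist o p)) (alpha t) p.
rewrite at_ (metric_sym (alpha t) p); lra.
Qed.

Variable (h : R -> R -> R -> R).
Hypothesis morse : morse_radius o (h delta).

Lemma morse_radius_ge0 q Q : 1 <= q -> 0 <= Q -> 0 <= h delta q Q.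
Proof.
move=> q1 Q0; have [m _] := morse.
(* The sign of [h] is obtained by testing the Morse property on the constant path at [o] over a
   one-point interval. *)
pose J : set R := `[0, 0]%classic; have J0 : J 0 by rewrite /J /= in_itv /= lexx.
have J1 s : J s -> s = 0.
  by rewrite /J /= in_itv /= => s0; apply/le_anti; rewrite andbC.
have g0 : geodesic J (cst o : R -> X).
  by move=> s t /J1 -> /J1 ->; rewrite mdistxx subrr normr0.
have qJ : quasi_geodesic q Q `[0, 0] (cst o : R -> X).
  split=> //; first exact: cst_continuous.
  move=> s t /J1 -> /J1 ->.
  by rewrite subrr normr0 mul0r sub0r mdistxx mulr0 add0r oppr_le0 Q0.
have im0 : ((cst o : R -> X) @` J) o by exists 0.
have Ji : is_interval J by apply: interval_is_interval.
have := m q Q J (cst o) 0 0 (cst o) Ji g0 (lexx _) qJ im0 im0 o im0.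
by apply: le_trans; apply: dist_set_ge0; exists o.
Qed.

Lemma geodesic_ray_kappa alpha : geodesic_ray o alpha -> kappa_ray o kappa alpha.
Proof.
move=> ga; split; first exact: geodesic_ray_quasi.
split; first exact: geodesic_ray_closed.
(* The summand [q + Q] makes the function proper; [h] alone is not known to be. *)
exists (fun q Q => Num.max (h delta q Q) (q + Q)).
  split; first by move=> q Q q1 Q0; rewrite le_max morse_radius_ge0.
  move=> C; exists C => q Q q1 Q0; rewrite ge_max => /andP[_ qQ]; split; lra.
move=> q Q a b beta ab qb za zb; have [m _] := morse.
move=> x bx; have [q1 Q0 _ _] := qb.
have Ji : is_interval (@half_line R) by apply: interval_is_interval.
apply: (le_trans (m q Q half_line alpha a b beta Ji ga.1 ab qb za zb x bx)).
apply: (@le_trans _ _ (Num.max (h delta q Q) (q + Q))); first by rewrite le_max lexx.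
by rewrite ler_peMr ?kappa_ge1 ?mdist_ge0 // le_max morse_radius_ge0.
Qed.

Lemma hit_time_geodesic alpha r : geodesic_ray o alpha -> 0 <= r ->
  hit_time o alpha r = r.
Proof.
move=> ga r0; rewrite /hit_time.
have -> : [set t | 0 <= t /\ mdist o (alpha t) = r] = [set r].
  apply/seteqP; split=> [t [t0]|_ ->]; last by split=> //; apply: geodesic_ray_norm.
  by rewrite (geodesic_ray_norm ga t0).
exact: inf1.
Qed.

(** Beyond radius [r], the intermediate value theorem would give an earlier time at radius [r],
    against the definition of [hit_time] as an infimum. *)
Lemma initial_part_norm beta r x : {within half_line, continuous beta} ->
  beta 0 = o -> 0 <= r -> initial_part o beta r x -> mdist o x <= r.
Proof.
move=> cb b0 r0 [t /=]; rewrite in_itv /= => /andP[t0 tT] <-.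
rewrite leNgt; apply/negP => rt.
have c0 : {within `[0, t], continuous (fun s => mdist o (beta s))}.
  apply: within_continuous_mdist; apply: continuous_subspaceW cb.
  by move=> s /=; rewrite in_itv /= => /andP[s0 _]; apply/half_lineP.
have [] := IVT t0 c0 (v := r).
  by rewrite b0 mdistxx ge_min r0 le_max (ltW rt) orbT.
move=> s; rewrite in_itv /= => /andP[s0 st] sr.
have : hit_time o beta r <= s.
  by apply: ge_inf => //; exists 0 => u [].
move=> Ts; have st' : s = t by apply/le_anti; rewrite st (le_trans tT Ts).
by move: rt; rewrite -st' sr ltxx.
Qed.

Variable rep : boundary o -> R -> X.
Hypothesis repP : geodesic_representatives rep.

Let rep_geo b : geodesic_ray o (rep b). Proof. exact: (repP b).1. Qed.
Let rep_rays b : rays_of b (rep b). Proof. exact: (repP b).2. Qed.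

Lemma kappa_class_rep b : kappa_class kappa b (rep b).
Proof.
split; first exact/geodesic_ray_kappa.
exists (rep b); split=> //; first exact: geodesic_ray_kappa.
rewrite /sublinearly_tracks.
under eq_fun do rewrite mdistxx mul0r.
exact: cvg_cst.
Qed.

(** Sublinear tracking, a priori weaker than finite Hausdorff distance, is enough in a hyperbolic
    space: it makes the products of [alpha] with the class of [beta] unbounded. *)
Lemma kappa_class_rays_of b beta : kappa_class kappa b beta -> rays_of b beta.
Proof.
move=> [[qb _] [alpha [ba ga _ tr]]].
have [b' b'b] := ray_boundary qb.
suff -> : b = b' by [].
apply: (boundary_eq_gromov_product ba (rep_rays b') ga (rep_geo b')) => N.
have [D D0 near_b] := asymptotic_near (rays_of_asymptotic b'b (rep_rays b')).
(* One radius with tracking error below [r / 2] suffices: the product is then at least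
   [r - (r / 2 + D) >= |N|]. *)
have [r [r1 rN rtr]] : exists r, [/\ 1 <= r, 2 * (D + `|N|) <= r &
    mdist (hit_point o alpha r) (hit_point o beta r) / r < 2^-1].
  have /cvgrPdist_lt/(_ 2^-1) tr2 := tr.
  have half0 : 0 < 2^-1 :> R by rewrite invr_gt0.
  have tr2' := tr2 half0.
  near (+oo : set_system R) => r; exists r; split.
  - by near: r; apply: nbhs_pinfty_ge; rewrite num_real.
  - by near: r; apply: nbhs_pinfty_ge; rewrite num_real.
  - have : `|0 - mdist (hit_point o alpha r) (hit_point o beta r) / r| < 2^-1.
      by near: r.
    rewrite sub0r normrN; apply: le_lt_trans; exact: ler_norm.
have r0 : 0 <= r by lra.
rewrite ltr_pdivrMr in rtr; last by lra.
rewrite /hit_point hit_time_geodesic // in rtr.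
(* If radius [r] were never hit, [hit_time] would be the infimum of the empty set, which is 0. *)
have T0 : 0 <= hit_time o beta r.
  have [[t Et]|E] := pselect ([set t | 0 <= t /\ mdist o (beta t) = r] !=set0).
    by apply: lb_le_inf; [exists t|move=> u []].
  rewrite /hit_time; move/set0P/negP/negPn/eqP: E => ->; by rewrite inf0.
have [u u0 hu] := near_b _ T0.
exists r, u; split=> //.
have au := metric_triangle (alpha r) (beta (hit_time o beta r)) (rep b' u).
have ou := metric_triangle o (rep b' u) (alpha r).
rewrite /gromov_product !(metric_sym _ o) in ou *.
rewrite (geodesic_ray_norm ga r0) (geodesic_ray_norm (rep_geo b') u0) in ou *.
rewrite (metric_sym (rep b' u)) in ou.
have := ler_norm N; lra.
Unshelve. all: by end_near. Qed.

Lemma radius_bound_le q Q :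
  [/\ q <= radius_bound delta h q Q &
      3 * h delta q Q + 30 * delta <= radius_bound delta h q Q].
Proof. by rewrite /radius_bound !le_max !lexx !orbT; split. Qed.

(* Within half of the Gromov product, a quasi-geodesic ray of [a] runs close to
   the representative of [a], hence to that of [b]. *)
Lemma U_kappa_fellow a b r s : 0 < r -> 0 <= s ->
  2 * r <= gromov_product o (rep a s) (rep b s) ->
  U_kappa kappa delta h (rep b) r a.
Proof.
have d0 := delta_ge0; move=> r0 s0 rg q Q beta cb qb Mr x px.
have ab := kappa_class_rays_of cb.
have [[q1 Q0 cont _] b0] := qb.
have kr : 1 <= kappa r by apply/kappa_ge1/ltW.
have [qM hM] := radius_bound_le q Q.
have h0 := morse_radius_ge0 q1 Q0.
set M := radius_bound _ _ _ _ in Mr qM hM *.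
have {}Mr : 24 * M < r.
  rewrite mulrC -ltr_pdivlMr //; apply: lt_le_trans Mr _.
  by rewrite ler_pM2l // lef_pV2 ?posrE; lra.
have xr := initial_part_norm cont b0 (ltW r0) px.
have [_ m2] := morse.
have hx : nbhd (rep a @` half_line) (h delta q Q) x.
  apply: (m2 q Q a (rep a) beta) => //.
  case: px => t /=; rewrite in_itv /= => /andP[t0 _] <-.
  by exists t => //; apply/half_lineP.
have xM : dist_set x (rep b @` half_line) <= M.
  apply/ler_addgt0Pl => e e0.
  pose e' := Num.min e (r / 2).
  have e'0 : 0 < e' by rewrite lt_min e0 divr_gt0.
  have [_ [u /half_lineP u0 <-] xu] := nbhdP (half_line_image_neq0 _) hx e'0.
  have e'e : e' <= e by rewrite ge_min lexx.
  have e'r : e' <= r / 2 by rewrite ge_min lexx orbT.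
  (* The parameter [u] exceeds [r] by at most [h + e'], and [3 * h <= M < r / 24]. This overshoot
     explains the factor 2 in the hypothesis on the product. *)
  have ur : u <= 2 * r.
    rewrite -(geodesic_ray_norm (rep_geo a) u0).
    have := metric_triangle o x (rep a u); lra.
  have := rays_fellow_travel (rep_geo a) (rep_geo b) u0 s0 s0 (le_trans ur rg).
  move=> ab_u; apply: (@dist_set_le _ _ _ (rep b u)).
    by exists u => //; apply/half_lineP.
  have := metric_triangle x (rep a u) (rep b u); lra.
apply: (le_trans xM); rewrite ler_peMr ?kappa_ge1 ?mdist_ge0 //; lra.
Qed.

Lemma sublinear_small (e : R) : 0 < e ->
  exists2 r0, 0 < r0 & forall r, r0 <= r -> kappa r / r < e.
Proof.
move=> e0; have [_ _ _ /cvgrPdist_lt/(_ e e0)] := kappaP.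
move=> [M [_ Mk]]; exists (`|M| + 1); first by rewrite ltr_wpDl.
move=> r Mr; have Mr' : M < r by have := ler_norm M; lra.
have := Mk r Mr'; rewrite sub0r normrN; apply: le_lt_trans; exact: ler_norm.
Qed.

(* The geodesic ray [rep a] is itself tested in [U_kappa]. *)
Lemma U_kappa_gromov_product : exists2 r0 : R, 0 < r0 &
  forall a b r, r0 <= r -> U_kappa kappa delta h (rep b) r a ->
    r <= 2 * gromov_product o (rep a r) (rep b r).
Proof.
(* [rep a] is a quasi-geodesic with constants 1 and 0, so this [M] is the only bound involved;
   beyond [r0] it satisfies the threshold in [U_kappa]. *)
set M := radius_bound delta h 1 0.
have M1 : 1 <= M by case: (radius_bound_le 1 0).
have M0 : 0 < 24 * M by lra.
have [r0 r00 small] : exists2 r0 : R, 0 < r0 &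
    forall r, r0 <= r -> kappa r / r < (24 * M)^-1.
  by apply: sublinear_small; rewrite invr_gt0.
exists r0 => // a b r r0r Ur.
have rp : 0 < r by lra.
have kr : 1 <= kappa r by apply/kappa_ge1/ltW.
have k0 : 0 < kappa r by lra.
have kM : 24 * M * kappa r < r.
  by have := small r r0r; rewrite ltr_pdivrMr // ltr_pdivlMl // mulr_gt0 //; lra.
have Mr : M < r / (24 * kappa r).
  by rewrite ltr_pdivlMr ?mulr_gt0 // mulrA (mulrC M).
have rp0 := ltW rp.
have qg : quasi_geodesic_ray_with 1 0 o (rep a).
  by case: (rep_geo a) => ga a0; split=> //; apply: geodesic_quasi.
have : kappa_nbhd o kappa (rep b @` half_line) M (rep a r).
  apply: (Ur 1 0 (rep a)) => //; first exact: kappa_class_rep.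
  by exists r; rewrite //= (hit_time_geodesic (rep_geo a) (ltW rp)) in_itv /= lexx ltW.
rewrite /kappa_nbhd /= (geodesic_ray_norm (rep_geo a) (ltW rp)) => dr.
have : dist_set (rep a r) (rep b @` half_line) < r / 24.
  by apply: (le_lt_trans dr); rewrite ltr_pdivlMr //; lra.
move/(dist_set_lt (half_line_image_neq0 _)) => [_ [u /half_lineP u0 <-] ru].
have := metric_triangle o (rep b u) (rep a r).
rewrite (metric_sym (rep b u)) !(geodesic_ray_norm (rep_geo _)) // => ur.
(* The product is at least [r] minus the distance, which is below [r / 24]. Passing from [rep b u]
   to [rep b r] costs nothing if [u <= r]; otherwise [u - r] is below [r / 24] as well. *)
have g : 23 / 24 * r <= gromov_product o (rep a r) (rep b u).
  rewrite /gromov_product !(metric_sym _ o).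
  rewrite !(geodesic_ray_norm (rep_geo _)) //; lra.
have [ur'|/ltW ru'] := lerP u r.
  rewrite gromov_productC in g.
  have := gromov_product_ray_mono (rep a r) (rep_geo b) u0 ur'.
  rewrite (gromov_productC o (rep b r)); lra.
have dru : mdist (rep b u) (rep b r) = u - r.
  by rewrite (geodesic_ray_dist (rep_geo b)) // ger0_norm // subr_ge0.
have := metric_triangle (rep a r) (rep b u) (rep b r).
rewrite /gromov_product !(metric_sym _ o) dru.
rewrite !(geodesic_ray_norm (rep_geo _)) //.
have := metric_triangle o (rep a r) (rep b u).
rewrite !(geodesic_ray_norm (rep_geo _)) //; lra.
Qed.


Lemma sup_radius_ge0 a b : (0 <= sup_radius kappa delta h rep a b)%E.
Proof. by apply: ereal_sup_ubound; exists 0 => //; left. Qed.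

Lemma gromov_product_le_sup_radius a b s : 0 <= s ->
  ((gromov_product o (rep a s) (rep b s) / 2)%:E <= sup_radius kappa delta h rep a b)%E.
Proof.
move=> s0; apply: ereal_sup_ubound; exists (gromov_product o (rep a s) (rep b s) / 2) => //.
have := gromov_product_ge0 o (rep a s) (rep b s); rewrite le_eqVlt => /predU1P[<-|g0].
  by left; rewrite mul0r.
by right; split; [apply: divr_gt0|apply: (@U_kappa_fellow _ _ _ s); lra].
Qed.

(** The upper bound needs a threshold [r0] because sublinearity of [kappa] acts only at large radii.
    Finiteness, which comes from [a] and [b] being distinct, makes [fine] harmless in [log_rho]. *)
Lemma fellow_radius_gromov_product : exists r0 : R, forall a b, a <> b ->
  exists r, [/\ fellow_radius kappa delta h rep a b = r%:E, 0 <= r,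
    forall s, 0 <= s -> gromov_product o (rep a s) (rep b s) <= 2 * r &
    forall N, (forall s, 0 <= s -> gromov_product o (rep a s) (rep b s) <= N) ->
      r <= Num.max r0 (2 * N)].
Proof.
have [r0 r00 upper] := U_kappa_gromov_product.
have sup_le a b N :
    (forall s, 0 <= s -> gromov_product o (rep a s) (rep b s) <= N) ->
    (sup_radius kappa delta h rep a b <= (Num.max r0 (2 * N))%:E)%E.
  move=> gN; apply: ge_ereal_sup => _ [r rU <-]; rewrite lee_fin.
  case: rU => [->|[rp Ur]]; first by rewrite le_max (ltW r00).
  rewrite le_max; have [//|/ltW r0r] := lerP r r0.
  apply: le_trans (upper a b r r0r Ur) _.
  by rewrite ler_pM2l //; apply/gN/ltW.
exists r0 => a b ab; rewrite /fellow_radius asboolF //.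
have [N gN] : exists N, forall s, 0 <= s -> gromov_product o (rep a s) (rep b s) <= N.
  apply: contrapT => /forallNP noN; apply: ab.
  apply: (boundary_eq_gromov_product (rep_rays a) (rep_rays b)) => // N.
  have /existsNP[s /not_implyP[s0 /negP]] := noN N.
  by rewrite -ltNge => /ltW; exists s, s.
have swap M : (forall s, 0 <= s -> gromov_product o (rep a s) (rep b s) <= M) ->
    forall s, 0 <= s -> gromov_product o (rep b s) (rep a s) <= M.
  by move=> gM s s0; rewrite gromov_productC gM.
set m := Order.min _ _.
have m_le M : (forall s, 0 <= s -> gromov_product o (rep a s) (rep b s) <= M) ->
    (m <= (Num.max r0 (2 * M))%:E)%E.
  by move=> gM; rewrite ge_min sup_le.
have m0 : (0 <= m)%E by rewrite le_min !sup_radius_ge0.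
have mfin : m \is a fin_num.
  by rewrite ge0_fin_numE //; apply: le_lt_trans (m_le N gN) _; rewrite ltry.
exists (fine m); rewrite fineK //; split=> //; first exact: fine_ge0.
- move=> s s0.
  suff : ((gromov_product o (rep a s) (rep b s) / 2)%:E <= m)%E.
    by rewrite -(fineK mfin) lee_fin; lra.
  rewrite le_min gromov_product_le_sup_radius //=.
  by rewrite gromov_productC gromov_product_le_sup_radius.
- by move=> M /m_le; rewrite -{1}(fineK mfin) lee_fin.
Qed.

Lemma log_rho_ge0 a b : 0 <= log_rho kappa delta h rep a b.
Proof.
rewrite /log_rho; case: ifP => // _; case: ifP => // _.
exact: exprz_ge0.
Qed.

(** For [r >= 2], with [n] the integer part of its binary logarithm, [log_rho] is [2 / 2 ^ n] while
    [2 ^ n <= r < 2 ^ (n + 1)]. For [r < 2] it is 1 and [1 + r < 3]. *)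
Lemma log_rho_bounds a b r : a <> b -> 0 <= r ->
  fellow_radius kappa delta h rep a b = r%:E ->
  1 <= log_rho kappa delta h rep a b * (1 + r) <= 6.
Proof.
move=> ab r0; rewrite /log_rho asboolF // => -> /=.
case: ltP => r2; first by rewrite mul1r; apply/andP; split; lra.
have ln20 : 0 < ln (2 : R) by rewrite ln_gt0 // ltr1n.
have rp : 0 < r by lra.
have [lo hi] : (Num.floor (ln r / ln 2))%:~R * ln 2 <= ln r /\
    ln r < ((Num.floor (ln r / ln 2))%:~R + 1) * ln 2.
  rewrite -ler_pdivlMr // -ltr_pdivrMr // floor_le; split=> //.
  by have := floorD1_gt (ln r / ln 2); rewrite intrD.
have n1 : 1 <= Num.floor (ln r / ln 2).
  by rewrite -(floor1 R); apply: le_floor; rewrite ler_pdivlMr // mul1r ler_ln ?posrE.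
(* [n1] excludes negative values of the floor, so that only natural powers of 2 remain. *)
case: (Num.floor _) lo hi n1 => // n lo hi n1; rewrite -pmulrn ?natr1 !mulr_natl in lo hi.
have nr : 2 ^+ n <= r.
  by rewrite -ler_ln ?posrE ?exprn_gt0 // lnXn.
have rn : r < 2 ^+ n.+1.
  by rewrite -ltr_ln ?posrE ?exprn_gt0 // lnXn.
rewrite expfzDr ?pnatr_eq0 // expr1z -exprnN -mulrA mulrC.
rewrite exprS in rn; have p0 : 0 < (2 : R) ^+ n by apply: exprn_gt0.
rewrite ler_pdivlMr // ler_pdivrMr //; apply/andP; split; lra.
Qed.

End Hyperbolic.

(** * Word length and the geometry of Cayley graphs *)

Section WordLength.
Variables (G : groupType) (S : fin_gen_set G).
Implicit Types (g h : G) (w : seq G).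

Fact word_exists g : exists n, `[< exists w,
  [/\ all (letter S) w, size w = n & g = (\prod_(x <- w) x)%g] >].
Proof.
have [w wS gw] := gensP S g.
by exists (size w); apply/asboolP; exists w.
Qed.

Definition word_length g : nat := ex_minn (word_exists g).

Lemma word_lengthP g : exists w,
  [/\ all (letter S) w, size w = word_length g & g = (\prod_(x <- w) x)%g].
Proof. by rewrite /word_length; case: ex_minnP => n /asboolP. Qed.

Lemma word_length_le w : all (letter S) w ->
  (word_length (\prod_(x <- w) x)%g <= size w)%N.
Proof.
move=> wS; rewrite /word_length; case: ex_minnP => n _; apply.
by apply/asboolP; exists w.
Qed.

Lemma word_length1 : word_length 1%g = 0%N.
Proof. by apply/eqP; rewrite -leqn0; have := @word_length_le [::] isT; rewrite big_nil. Qed.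

Lemma word_length_eq0 g : word_length g = 0%N -> g = 1%g.
Proof.
move=> g0; have [w [_ ws ->]] := word_lengthP g.
by rewrite g0 in ws; rewrite (size0nil ws) big_nil.
Qed.

Lemma word_lengthM g h : (word_length (g * h)%g <= word_length g + word_length h)%N.
Proof.
have [v [vS <- gE]] := word_lengthP g; have [w [wS <- hE]] := word_lengthP h.
rewrite [in leqLHS]gE [in leqLHS]hE -big_cat -size_cat.
by apply: word_length_le; rewrite all_cat vS.
Qed.

Lemma letterV g : letter S g^-1%g = letter S g.
Proof. by rewrite /letter invgK orbC. Qed.

Lemma word_length_letter g : letter S g -> (word_length g <= 1)%N.
Proof.
by move=> gS; have := @word_length_le [:: g]; rewrite big_seq1 /= gS => /(_ isT).
Qed.

Lemma word_lengthV g : word_length g^-1%g = word_length g.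
Proof.
suff le x : (word_length x^-1%g <= word_length x)%N.
  by apply/eqP; rewrite eqn_leq le /=; have := le g^-1%g; rewrite invgK.
have [w [+ <- ->]] := word_lengthP x.
elim: w {x} => [|y w IH] /=; first by rewrite big_nil invg1 word_length1.
move=> /andP[yS /IH {}IH]; rewrite big_cons invgM.
apply: leq_trans (word_lengthM _ _) _; rewrite -[leqRHS]addn1; apply: leq_add => //.
by apply: word_length_letter; rewrite letterV.
Qed.

Lemma adjeqP g h : adjeq S g h <-> (word_length (g^-1 * h)%g <= 1)%N.
Proof.
split.
  by case=> [->|]; [rewrite mulVg word_length1|apply: word_length_letter].
have [w [wS <- e]] := word_lengthP (g^-1 * h)%g.
case: w wS e => [|x [|y w]] //= wS; rewrite ?big_nil ?big_seq1 => e _.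
  by left; rewrite -[h](mulVKg g) e mulg1.
by right; rewrite e; case/andP: wS.
Qed.

Lemma word_lengthD x g h :
  (word_length (g^-1 * h)%g <= word_length (g^-1 * x)%g + word_length (x^-1 * h)%g)%N.
Proof. by rewrite -[h in (leqLHS)](mulVKg x) mulgA word_lengthM. Qed.

Lemma word_lengthC g h : word_length (g^-1 * h)%g = word_length (h^-1 * g)%g.
Proof. by rewrite -word_lengthV invgM invgK. Qed.

(** The path waits at [h] once it has arrived, as [adjeq] permits; this allows padding to a
    prescribed length. *)
Lemma word_path g h : exists v : nat -> G,
  [/\ forall k, adjeq S (v k) (v k.+1), v 0%N = g,
      v (word_length (g^-1 * h)%g) = h &
      forall k, (word_length (g^-1 * h)%g <= k)%N -> v k = h].
Proof.
have [w [wS <- e]] := word_lengthP (g^-1 * h)%g.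
have he : h = (g * \prod_(x <- w) x)%g by rewrite -e mulVKg.
have hk k : (size w <= k)%N -> (g * \prod_(x <- take k w) x)%g = h.
  by move=> wk; rewrite take_oversize.
exists (fun k => g * \prod_(x <- take k w) x)%g.
split; [|by rewrite take0 big_nil mulg1|exact: hk|exact: hk].
move=> k; have [kw|wk] := ltnP k (size w); last by left; rewrite !hk // ltnW.
right; rewrite (take_nth 1%g kw) -cats1 big_cat big_seq1 /= (mulgA g) mulKg.
exact: (allP wS (nth 1%g w k) (mem_nth _ kw)).
Qed.

Lemma word_path_length (v : nat -> G) i j : (forall k, adjeq S (v k) (v k.+1)) ->
  (i <= j)%N -> (word_length ((v i)^-1 * v j)%g <= j - i)%N.
Proof.
move=> vS; elim: j => [|j IH]; first by rewrite leqn0 => /eqP ->; rewrite mulVg word_length1.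
rewrite leq_eqVlt => /predU1P[->|]; first by rewrite mulVg word_length1.
rewrite ltnS => ij; rewrite subSn //.
apply: leq_trans (word_lengthD (v j) _ _) _; rewrite -[leqRHS]addn1.
by apply: leq_add; [apply: IH|apply/adjeqP].
Qed.

Lemma word_length_between g h k : (k <= word_length (g^-1 * h)%g)%N ->
  exists2 x, word_length (g^-1 * x)%g = k &
    (word_length (g^-1 * x)%g + word_length (x^-1 * h)%g)%N = word_length (g^-1 * h)%g.
Proof.
move=> kn; have [v [vS v0 vn _]] := word_path g h.
have := word_path_length vS (leq0n k); have := word_path_length vS kn.
rewrite v0 vn subn0 => H1 H2; have H3 := word_lengthD (v k) g h.
by exists (v k); lia.
Qed.

Lemma letters_finite : exists L : seq G, forall x, letter S x -> x \in L.
Proof.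
exists ((S : seq G) ++ [seq x^-1%g | x <- (S : seq G)]) => x.
rewrite mem_cat /letter => /orP[->//|xS]; apply/orP; right.
by apply/mapP; exists x^-1%g; rewrite ?invgK.
Qed.

(** Local finiteness of the Cayley graph, which will turn a bound on length in the group into one on
    length in the subgroup. *)
Lemma ball_finite n : exists L : seq G, forall x, (word_length x <= n)%N -> x \in L.
Proof.
elim: n => [|n [L HL]].
  by exists [:: 1%g] => x; rewrite leqn0 => /eqP/word_length_eq0 ->; rewrite mem_head.
have [A HA] := letters_finite.
exists (L ++ [seq (x * y)%g | x <- L, y <- A]) => x.
rewrite mem_cat leq_eqVlt => /predU1P[xn|/HL -> //]; apply/orP; right.
have [|y yn] := @word_length_between 1%g x n; first by rewrite invg1 mul1g xn.
rewrite yn; rewrite invg1 !mul1g in yn * => e.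
apply/allpairsP; exists (y, (y^-1 * x)%g); split=> //=.
- by apply: HL; rewrite yn.
- apply: HA; have /adjeqP[e1|//] : (word_length (y^-1 * x)%g <= 1)%N by lia.
  by move: yn; rewrite e1 xn; lia.
- by rewrite mulVKg.
Qed.

End WordLength.

(** It suffices to bound the images of the finitely many letters. The lemma serves for the inclusion
    and, with the identity, for changing generating sets; [L] is kept positive because it becomes
    the number of steps per edge in [subdivided_path]. *)
Lemma word_length_lipschitz (H G : groupType) (SH : fin_gen_set H) (SG : fin_gen_set G)
    (f : H -> G) : (forall x y, f (x * y)%g = (f x * f y)%g) ->
  exists2 L : nat, (0 < L)%N &
    forall x, (word_length SG (f x) <= L * word_length SH x)%N.
Proof.
move=> fM.
have f1 : f 1%g = 1%g by apply: (@mulgI _ (f 1%g)); rewrite -fM !mulg1.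
have [A HA] := letters_finite SH.
have [L L0 HL] : exists2 L : nat, (0 < L)%N &
    forall x, x \in A -> (word_length SG (f x) <= L)%N.
  elim: A {HA} => [|y A [L L0 HL]]; first by exists 1%N.
  exists (L + word_length SG (f y))%N; first by rewrite addn_gt0 L0.
  move=> x; rewrite inE => /predU1P[->|/HL xL]; first exact: leq_addl.
  exact: leq_trans xL (leq_addr _ _).
exists L => // x; have [w [+ <- ->]] := word_lengthP SH x.
elim: w {x} => [|y w IH] /=; first by rewrite big_nil f1 word_length1.
move=> /andP[yS /IH {}IH]; rewrite big_cons fM mulnS.
apply: leq_trans (word_lengthM _ _ _) _.
by apply: leq_add IH; apply/HL/HA.
Qed.

(** * The path metric of the Cayley graph in terms of words *)

Section CayleyGeometry.
Variables (R : realType) (G : groupType) (S : fin_gen_set G).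
Implicit Types (x y : cayley R S) (g h : G) (t : R).

Lemma bary0 g h : bary g h 0 = (fun u => (u == g)%:R) :> (G -> R).
Proof. by apply/funext => u; rewrite /bary subr0 mul1r mul0r addr0. Qed.

Lemma bary1 g h : bary g h 1 = (fun u => (u == h)%:R) :> (G -> R).
Proof. by apply/funext => u; rewrite /bary subrr mul1r mul0r add0r. Qed.

(* For [a] in the support of [x], [1 - x a] is the distance from [x] to [a]
   along an edge containing [x]. *)
Lemma segment_support x y l a : segment_length x y l -> x a != 0 ->
  exists2 b, y b != 0 & (word_length S (a^-1 * b)%g)%:R + (1 - y b) <= l + (1 - x a).
Proof.
move=> sxy xa; have := segment_weight a sxy; rewrite ler_norml => /andP[_ lxy].
have [ya|ya] := eqVneq (y a) 0; last first.
  by exists a => //; rewrite mulVg word_length1; lra.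
rewrite ya subr0 in lxy.
(* Losing [a] from the support while staying on one edge forces [y] to be the opposite vertex. *)
suff [b yb ab] : exists2 b, y b = 1 & (word_length S (a^-1 * b)%g <= 1)%N.
  exists b; rewrite yb ?oner_eq0 //.
  by have : (word_length S (a^-1 * b)%g)%:R <= 1 :> R; [rewrite lern1|lra].
have [g [h [gh [t _ xE] [u _ yE] _]]] := sxy.
move: xa ya; rewrite xE yE /bary.
have [<-|] := eqVneq g h.
  by case: (a == g); rewrite ?mulr1 ?mulr0 ?addr0 ?eqxx // !subrK => _ /eqP; rewrite oner_eq0.
have [->|ag] := eqVneq a g => neq.
  rewrite (negbTE neq) !mulr1 !mulr0 !addr0 => _ u1.
  exists h; last exact/adjeqP.
  by rewrite eq_sym (negbTE neq) eqxx mulr0 mulr1 add0r; lra.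
have [->|ah] := eqVneq a h; last by rewrite !mulr0 !addr0 eqxx.
rewrite !mulr1 !mulr0 !add0r => _ u0; exists g; last by rewrite word_lengthC; apply/adjeqP.
by rewrite eqxx (negbTE neq) u0 subr0 mulr1 mul0r addr0.
Qed.

Lemma chain_support x y l a : chain_length x y l -> x a != 0 ->
  exists2 b, y b != 0 & (word_length S (a^-1 * b)%g)%:R + (1 - y b) <= l + (1 - x a).
Proof.
move=> c; elim: c a => [u a ua|u v w l1 l2 uv _ IH a /(segment_support uv)[b vb ab]].
  by exists a => //; rewrite mulVg word_length1; lra.
have [c wc bc] := IH b vb; exists c => //.
have : (word_length S (a^-1 * c)%g)%:R <= (word_length S (a^-1 * b)%g)%:R
    + (word_length S (b^-1 * c)%g)%:R :> R.
  by rewrite -natrD ler_nat word_lengthD.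
lra.
Qed.

Lemma mdist_segment x y l : segment_length x y l -> mdist x y <= l.
Proof. by move=> /chain1; apply: ge_inf; case: (chain_has_inf x y). Qed.

Lemma mdist_adjeq g h : adjeq S g h -> mdist (vertex S g : cayley R S) (vertex S h) <= 1.
Proof.
move=> gh; apply: (@le_trans _ _ `|(1 : R) - (g == h)%:R|); last first.
  by case: (g == h); rewrite ?subrr ?subr0 ?normr0 ?normr1.
apply: mdist_segment; exists g, h; split=> //=; last by rewrite eqxx.
  by exists 0; rewrite ?bary0 ?lexx ?ler01.
by exists 1; rewrite ?bary1 ?lexx ?ler01.
Qed.

Lemma mdist_path_le (v : nat -> G) i j : (forall k, adjeq S (v k) (v k.+1)) ->
  (i <= j)%N -> mdist (vertex S (v i) : cayley R S) (vertex S (v j)) <= (j - i)%:R.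
Proof.
move=> vS; elim: j => [|j IH]; first by rewrite leqn0 => /eqP ->; rewrite mdistxx.
rewrite leq_eqVlt => /predU1P[->|]; first by rewrite mdistxx subnn.
rewrite ltnS => ij; rewrite subSn // -natr1.
apply: le_trans (metric_triangle _ (vertex S (v j)) _) _.
by apply: lerD; [apply: IH|apply: mdist_adjeq].
Qed.

(** For the lower bound, [chain_support] carries the support along any chain, and the support of
    [vertex S h] is [h] alone. *)
Lemma mdist_vertex g h :
  mdist (vertex S g : cayley R S) (vertex S h) = (word_length S (g^-1 * h)%g)%:R.
Proof.
apply/le_anti/andP; split.
  have [v [vS v0 vn _]] := word_path S g h.
  by have := mdist_path_le vS (leq0n (word_length S (g^-1 * h)%g)); rewrite v0 vn subn0.
apply: lb_le_inf; first exact: chain_nonempty.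
move=> l c; have [|b] := chain_support c (a := g); first by rewrite /= eqxx oner_eq0.
rewrite /= eqxx.
have [->|] := eqVneq b h; last by rewrite eqxx.
by rewrite /= !subrr !addr0.
Qed.

Lemma near_vertex x : exists g, mdist x (vertex S g) <= 1.
Proof.
have [g [h [gh xE]]] := weightP x; exists g.
have sx : segment_length x (vertex S g) `|x g - (vertex S g : cayley R S) g|.
  by exists g, h; split=> //; exists 0; rewrite ?bary0 ?lexx ?ler01.
apply: le_trans (mdist_segment sx) _; case: xE => t /andP[t0 t1] ->.
rewrite /bary /= eqxx mulr1.
have [_|_] := eqVneq g h; first by rewrite mulr1 subrK subrr normr0.
by rewrite mulr0 addr0 addrAC subrr sub0r normrN ger0_norm.
Qed.

Section PathMap.
Variables (v : nat -> G) (vS : forall k, adjeq S (v k) (v k.+1)).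

Let pos t := Num.max 0 t.

Fact edge_path_subproof t : exists g h, adjeq S g h /\
  on_edge g h (bary (v (Num.truncn (pos t))) (v (Num.truncn (pos t)).+1)
                    (pos t - (Num.truncn (pos t))%:R)).
Proof.
exists (v (Num.truncn (pos t))), (v (Num.truncn (pos t)).+1); split=> //.
exists (pos t - (Num.truncn (pos t))%:R) => //.
have /truncn_itv : 0 <= pos t by rewrite le_max lexx.
by rewrite -natr1 => /andP[? ?]; apply/andP; split; lra.
Qed.

(* Negative times are sent to [v 0]. *)
Definition edge_path t : cayley R S := Cayley (edge_path_subproof t).

Lemma edge_path_edge t k : k%:R <= t -> t <= k.+1%:R ->
  weight (edge_path t) = bary (v k) (v k.+1) (t - k%:R).
Proof.
move=> kt tk; have t0 : 0 <= t by apply: le_trans kt.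
have pt : pos t = t by apply/max_idPr.
rewrite /= pt; move: tk; rewrite le_eqVlt => /predU1P[->|tk].
  by rewrite natrK subrr bary0 -natr1 addrC addKr bary1.
by have /truncn_def -> : k%:R <= t < k.+1%:R by rewrite kt.
Qed.

Lemma edge_path_nat k : edge_path k%:R = vertex S (v k).
Proof.
by apply: cayley_eq; rewrite (@edge_path_edge _ k) ?ler_nat // subrr bary0.
Qed.

Let edge_path_edge_dist s t k : k%:R <= s -> s <= t -> t <= k.+1%:R ->
  mdist (edge_path s) (edge_path t) <= t - s.
Proof.
move=> ks st tk.
have st' : segment_length (edge_path s) (edge_path t)
    `|edge_path s (v k) - edge_path t (v k)|.
  exists (v k), (v k.+1); split=> //.
    exists (s - k%:R); last by apply: edge_path_edge => //; apply: le_trans tk.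
    by move: tk; rewrite -natr1 => tk; apply/andP; split; lra.
  exists (t - k%:R); last by apply: edge_path_edge => //; apply: le_trans st.
  by move: tk; rewrite -natr1 => tk; apply/andP; split; lra.
apply: le_trans (mdist_segment st') _.
rewrite (edge_path_edge ks (le_trans st tk)) (edge_path_edge (le_trans ks st) tk) /bary eqxx.
case: (v k == v k.+1); rewrite !mulr1 ?mulr0 ?subrK ?addr0 ?subrr ?normr0; first lra.
rewrite ger0_norm; lra.
Qed.

Lemma edge_path_lipschitz s t : 0 <= s -> s <= t ->
  mdist (edge_path s) (edge_path t) <= t - s.
Proof.
move=> s0 st; have t0 := le_trans s0 st.
have /andP[ks sk] := truncn_itv s0; have /andP[jt tj] := truncn_itv t0.
have := le_truncn st; rewrite leq_eqVlt => /predU1P[e|].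
  by apply: (edge_path_edge_dist ks) => //; apply: ltW; rewrite e.
set i := Num.truncn s in ks sk *; set j := Num.truncn t in jt tj *; move=> ij.
have d1 := edge_path_edge_dist ks (ltW sk) (lexx _).
have d2 := mdist_path_le vS ij.
have d3 := edge_path_edge_dist (lexx _) jt (ltW tj).
have := metric_triangle (edge_path s) (edge_path i.+1%:R) (edge_path t).
have := metric_triangle (edge_path i.+1%:R) (edge_path j%:R) (edge_path t).
rewrite !edge_path_nat in d1 d2 d3 *; rewrite natrB // in d2; lra.
Qed.

Lemma edge_path_lipschitz_norm s t : 0 <= s -> 0 <= t ->
  mdist (edge_path s) (edge_path t) <= `|s - t|.
Proof.
move=> s0 t0; have [st|/ltW ts] := lerP s t.
  exact: edge_path_lipschitz.
by rewrite metric_sym edge_path_lipschitz.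
Qed.

(** A 1-Lipschitz path whose ends are as far apart as its length cannot lose distance in between. *)
Lemma edge_path_geodesic n :
  mdist (vertex S (v 0%N) : cayley R S) (vertex S (v n)) = n%:R ->
  geodesic `[0, n%:R] edge_path.
Proof.
move=> vn.
suff H s t : 0 <= s -> s <= t -> t <= n%:R -> mdist (edge_path s) (edge_path t) = t - s.
  move=> s t; rewrite /= !in_itv /= => /andP[s0 sn] /andP[t0 tn].
  have [st|/ltW ts] := lerP s t; first by rewrite H.
  by rewrite metric_sym H.
move=> s0 st tn; apply/le_anti; rewrite edge_path_lipschitz //=.
have d1 := edge_path_lipschitz (lexx _) s0.
have d2 := edge_path_lipschitz (le_trans s0 st) tn.
have := metric_triangle (edge_path 0) (edge_path s) (edge_path n%:R).
have := metric_triangle (edge_path s) (edge_path t) (edge_path n%:R).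
have p0 : edge_path 0 = vertex S (v 0%N) by rewrite -(edge_path_nat 0%N).
have p0n : mdist (edge_path 0) (edge_path n%:R) = n%:R by rewrite p0 edge_path_nat.
lra.
Qed.

Lemma edge_path_ray :
  (forall n, mdist (vertex S (v 0%N) : cayley R S) (vertex S (v n)) = n%:R) ->
  geodesic_ray (vertex S (v 0%N)) edge_path.
Proof.
move=> vn; split; last by rewrite -(edge_path_nat 0%N).
move=> s t /half_lineP s0 /half_lineP t0.
pose n := (Num.truncn (Num.max s t)).+1.
have mn : Num.max s t <= n%:R.
  by have /truncn_itv/andP[_ /ltW] : 0 <= Num.max s t by rewrite le_max s0.
apply: (edge_path_geodesic (vn n)); rewrite /= in_itv /= ?s0 ?t0 /=;
  by apply: le_trans mn; rewrite le_max lexx ?orbT.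
Qed.

End PathMap.
End CayleyGeometry.
Arguments edge_path R {G S v} vS t.

(** * The Gromov compactification *)

Section Compactification.
Variables (R : realType) (G : groupType) (S : fin_gen_set G) (delta : R).
Hypotheses (delta_ge0 : 0 <= delta) (hypG : gromov_hyperbolic (cayley R S) delta).
Variable rep : group_boundary R S -> R -> cayley R S.
Hypothesis repP : geodesic_representatives rep.
Implicit Types (y z : gromov_compactification R S) (c : group_boundary R S) (N M : R).

Let e : cayley R S := vertex S 1%g.

(** A lower bound on the extended product with the ray of [c] fixed. The supremum over all rays
    gains at most [delta], and this form can be chained by the hyperbolic inequality. *)
Definition product_ge N y c : Prop := exists alpha T,
  representatives y alpha /\
  forall s t, T <= s -> T <= t -> N <= gromov_product e (alpha s) (rep c t).

Lemma product_ge_extended N y c : product_ge N y c ->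
  (N%:E <= extended_gromov_product y (BoundaryPoint c))%E.
Proof.
move=> [alpha [T [ya gN]]]; apply: ereal_sup_ubound; exists N => //.
by exists alpha, (rep c), T; split=> //; case: (repP c).
Qed.

Lemma extended_product_ge N y c :
  (N%:E < extended_gromov_product y (BoundaryPoint c))%E -> product_ge (N - delta) y c.
Proof.
move/ereal_sup_gt => [_ [N' [alpha [beta [T [ya cb gN]]]] <-]]; rewrite lte_fin => NN'.
have [T' _ cvg] := gromov_product_rays_cvg N' (repP c).2 cb (repP c).1.
exists alpha, (Num.max T T'); split=> // s t; rewrite !ge_max => /andP[Ts _] /andP[_ Tt].
apply: (@le_trans _ _ (N' - delta)); first by rewrite lerD2r ltW.
apply: (gromov_product_trans hypG (y := beta (Num.max T T'))).
  by apply: gN => //; rewrite le_max lexx.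
by apply: cvg => //; rewrite le_max lexx orbT.
Qed.

Lemma product_ge_trans N z c c' : product_ge N z c' -> product_ge N (BoundaryPoint c') c ->
  product_ge (N - 2 * delta) z c.
Proof.
move=> [alpha [T1 [za g1]]] [beta [T2 [cb g2]]].
have [T3 _ cvg] := gromov_product_rays_cvg N (repP c').2 cb (repP c').1.
pose T := Num.max T1 (Num.max T2 T3).
have [TT1 TT2 TT3] : [/\ T1 <= T, T2 <= T & T3 <= T].
  by rewrite /T !le_max !lexx !orbT.
exists alpha, T; split=> // s t Ts Tt.
apply: (gromov_product_trans4 delta_ge0 hypG (y := rep c' T) (z := beta T)).
- by apply: g1 => //; apply: le_trans Ts.
- by rewrite gromov_productC; apply: cvg.
- by apply: g2 => //; apply: le_trans Tt.
Qed.

Lemma product_ge_refl N c : product_ge N (BoundaryPoint c) c.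
Proof.
have [T _ cvg] := gromov_product_rays_cvg N (repP c).2 (repP c).2 (repP c).1.
by exists (rep c), T; split=> //; case: (repP c).
Qed.

(* The sets [fun y => N < (y | c)] need not be open themselves. *)
Lemma extended_product_nbhs c N : exists U : set (gromov_compactification R S),
  [/\ compactification_open U, U (BoundaryPoint c) &
      forall y, U y -> (N%:E < extended_gromov_product y (BoundaryPoint c))%E].
Proof.
pose V y : Prop := (N%:E < extended_gromov_product y (BoundaryPoint c))%E.
(* On the boundary, [U] consists of the points with a basic neighbourhood inside [V]; hyperbolicity
   makes it open. *)
pose U y : Prop := match y with
  | GroupPoint _ => V y
  | BoundaryPoint c' => exists M, forall z,
      (M%:E < extended_gromov_product z (BoundaryPoint c'))%E -> V z
  end.
exists U; split.
(* Turning an extended product into [product_ge] costs [delta] and chaining costs [2 * delta], which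
   leaves [M + 1 > M]. *)
- move=> b [M MV]; exists (M + 1 + 3 * delta) => y My.
  have d0 := delta_ge0; case: y My => [g|b'] My /=.
    by apply: MV; apply: le_lt_trans My; rewrite lee_fin; lra.
  exists (M + 1 + 3 * delta) => z /extended_product_ge zM; apply: MV.
  have := product_ge_extended (product_ge_trans zM (extended_product_ge My)).
  by apply: lt_le_trans; rewrite lte_fin; lra.
- by exists N.
- case=> [g //|c' [M MV]]; apply: MV.
  apply: lt_le_trans (product_ge_extended (product_ge_refl (M + 1) c')).
  by rewrite lte_fin ltrDl.
Qed.

End Compactification.

(** Continuity at the boundary point [a], made quantitative: [M] depends on [a] and [N] only, while
    [T'] may vary with [x]. *)
Lemma cannon_thurston_product (R : realType) (G H : groupType)
    (SG : fin_gen_set G) (SH : fin_gen_set H) (deltaG : R)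
    (deltaG_ge0 : 0 <= deltaG) (hypG : gromov_hyperbolic (cayley R SG) deltaG)
    (repG : group_boundary R SG -> R -> cayley R SG)
    (repH : group_boundary R SH -> R -> cayley R SH)
    (repGP : geodesic_representatives repG)
    (repHP : geodesic_representatives repH)
    (i : H -> G) (di : group_boundary R SH -> group_boundary R SG)
    (diP : cannon_thurston i di) (a : group_boundary R SH) (N : R) :
  exists M : R, forall (x : H) (T : R),
    (forall t, T <= t ->
       M <= gromov_product (vertex SH 1%g) (vertex SH x) (repH a t)) ->
    exists T', forall t, T' <= t ->
       N <= gromov_product (vertex SG 1%g) (vertex SG (i x)) (repG (di a) t).
Proof.
have [F [cF Fg Fb]] := diP.
(* [deltaG] is added in advance to offset the loss in [extended_product_ge]. *)
have [U [oU Ua UN]] := extended_product_nbhs deltaG_ge0 hypG repGP (di a) (N + deltaG).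
have oF : compactification_open (F @^-1` U).
  by move/continuousP: cF => /(_ U oU).
have Fa : (F @^-1` U) (BoundaryPoint a) by rewrite /preimage /= Fb.
have [M MU] := oF a Fa.
exists (M + 1) => x T gx.
have : product_ge repH (M + 1) (GroupPoint R SH x) a.
  by exists (cst (vertex SH x)), T; split=> // s t _; apply: gx.
move=> /(product_ge_extended repHP) Mx.
have /MU : (M%:E < extended_gromov_product (GroupPoint R SH x) (BoundaryPoint a))%E.
  by apply: lt_le_trans Mx; rewrite lte_fin ltrDl.
rewrite /preimage /= Fg => /UN/(extended_product_ge hypG repGP).
move=> [alpha [T' [-> gN]]]; exists T' => t Tt.
by have := gN T' t (lexx _) Tt; rewrite addrK.
Qed.

(** * Quasiconvex subgroups *)

Section GeodesicPaths.
Variables (G : groupType) (S : fin_gen_set G).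

Lemma word_path_through (x z y : G) :
  (word_length S (x^-1 * z)%g + word_length S (z^-1 * y)%g)%N
    = word_length S (x^-1 * y)%g ->
  exists p : nat -> G, [/\ forall k, adjeq S (p k) (p k.+1), p 0%N = x,
    p (word_length S (x^-1 * z)%g) = z & p (word_length S (x^-1 * y)%g) = y].
Proof.
move=> <-; have [p [pS p0 pz pz']] := word_path S x z.
have [r [rS r0 ry _]] := word_path S z y.
set m := word_length S (x^-1 * z)%g in pz pz' *.
exists (fun k => if (k <= m)%N then p k else r (k - m)%N); split=> //.
- move=> k; have [km|mk] := ltnP k m; first by rewrite ltnW.
  have [km|{}mk] := leqP k m; last by rewrite subSn ?(ltnW mk).
  have -> : k = m by lia.
  by rewrite subSn // subnn pz -r0.
- by rewrite leqnn.
- rewrite addKn; case: leqP => // le.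
  have n0 : word_length S (z^-1 * y)%g = 0%N by move: le; lia.
  by rewrite n0 addn0 pz -ry n0 r0.
Qed.

Lemma word_path_geodesic (p : nat -> G) n j k : (forall k, adjeq S (p k) (p k.+1)) ->
  word_length S ((p 0%N)^-1 * p n)%g = n -> (j <= k)%N -> (k <= n)%N ->
  word_length S ((p j)^-1 * p k)%g = (k - j)%N.
Proof.
move=> pS pn jk kn.
have := word_path_length pS jk; have := word_path_length pS kn.
have := word_path_length pS (leq0n j).
have := word_lengthD S (p j) (p 0%N) (p n); have := word_lengthD S (p k) (p j) (p n).
lia.
Qed.

End GeodesicPaths.

(** * Quasi-isometric embedding of a quasiconvex subgroup *)

Section QuasiIsometricEmbedding.
Variables (R : realType) (H G : groupType) (SH : fin_gen_set H) (SG : fin_gen_set G).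
Variable i : H -> G.
Hypotheses (iM : forall x y, i (x * y)%g = (i x * i y)%g) (i_inj : injective i).

Lemma morph1 : i 1%g = 1%g.
Proof. by apply: (@mulgI _ (i 1%g)); rewrite -iM !mulg1. Qed.

Lemma morphV x : i x^-1%g = (i x)^-1%g.
Proof. by apply: (@mulgI _ (i x)); rewrite -iM !mulgV morph1. Qed.

Lemma morphVM x y : i (x^-1 * y)%g = ((i x)^-1 * i y)%g.
Proof. by rewrite iM morphV. Qed.

Lemma word_length_bounded (A : seq G) :
  exists K, forall x, i x \in A -> (word_length SH x <= K)%N.
Proof.
elim: A => [|g A [K HK]]; first by exists 0%N.
have [[x0 x0g]|nog] := pselect (exists x, i x = g).
  exists (K + word_length SH x0)%N => x; rewrite inE => /predU1P[|/HK xK].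
    by rewrite -x0g => /i_inj ->; apply: leq_addl.
  exact: leq_trans xK (leq_addr _ _).
exists K => x; rewrite inE => /predU1P[xg|]; last exact: HK.
by case: nog; exists x.
Qed.

(** Elements of the subgroup follow a geodesic of [G] from 1 to [i x] at distance at most [B].
    Consecutive ones differ by an element of a fixed finite ball, whose preimage in [H] has bounded
    length because [i] is injective. *)
Lemma quasiconvex_embedding : quasiconvex R (range i) ->
  exists2 K : nat, (0 < K)%N & forall x,
    (word_length SH x <= K * word_length SG (i x) + K)%N.
Proof.
move=> [S [r r0 qc]].
pose B := Num.truncn (r + 1).
(* [B] at each end, and 1 for the step along the geodesic. *)
have [L HL] := ball_finite S (B + B).+1.
have [K HK] := word_length_bounded L.
(* Quasiconvexity furnishes its own generating set [S], so lengths have to be converted to [SG]. *)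
have [M M0 HM] := @word_length_lipschitz G G SG S id (fun _ _ => erefl).
exists (K * M).+1 => // x.
have [v [vS v0 vn _]] := word_path S 1%g (i x).
rewrite invg1 mul1g in vn; set n := word_length S (i x) in vn.
have gv : geodesic `[0, n%:R] (edge_path R vS).
  by apply: edge_path_geodesic; rewrite v0 vn mdist_vertex invg1 mul1g.
have near_H j : (j <= n)%N -> exists y, (word_length S ((v j)^-1 * i y)%g <= B)%N.
  move=> jn.
  have hv : nbhd (vertex S @` range i) r (edge_path R vS j%:R).
    apply: (qc 0 n%:R _ _ gv) => //.
    - by exists 1%g; [exists 1%g => //; exact: morph1|rewrite -v0 -(edge_path_nat R vS)].
    - by exists (i x); [exists x|rewrite edge_path_nat vn].
    - by exists j%:R => //=; rewrite in_itv /= ler0n ler_nat.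
  have ne : [set (vertex S g : cayley R S) | g in range i] !=set0.
    by exists (vertex S (i 1%g)), (i 1%g) => //; exists 1%g.
  have [_ [_ [y _ <-] <-]] := nbhdP ne hv ltr01.
  rewrite edge_path_nat mdist_vertex => yB; exists y.
  by rewrite /B truncn_ge_nat; [apply: ltW|apply: addr_ge0].
have step j : (j <= n)%N -> exists2 y, (word_length S ((v j)^-1 * i y)%g <= B)%N &
    (word_length SH y <= K * j)%N.
  elim: j => [_|j IH jn].
    by exists 1%g; rewrite ?v0 ?morph1 ?invg1 ?mulg1 ?word_length1.
  have [y yB yK] := IH (ltnW jn); have [y' yB'] := near_H j.+1 jn.
  exists y' => //; rewrite mulnS.
  have : (word_length SH (y^-1 * y')%g <= K)%N.
    apply: HK; apply: HL; rewrite morphVM.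
    have := word_lengthD S (v j) (i y) (i y').
    have := word_lengthD S (v j.+1) (v j) (i y').
    have := iffLR (adjeqP S _ _) (vS j); rewrite (word_lengthC S (i y) (v j)); lia.
  have := word_lengthM SH y (y^-1 * y')%g; rewrite mulVKg; lia.
have [y yB yK] := step n (leqnn n).
have : (word_length SH (y^-1 * x)%g <= K)%N.
  apply: HK; apply: HL; rewrite morphVM -vn word_lengthC; lia.
have := word_lengthM SH y (y^-1 * x)%g; rewrite mulVKg.
have := HM (i x); rewrite -/n => nM.
have : (K * n <= K * (M * word_length SG (i x)))%N by rewrite leq_mul2l nM orbT.
rewrite mulnA => *; nia.
Qed.

Variables (K L : nat).
Hypotheses (K0 : (0 < K)%N) (L0 : (0 < L)%N).
Hypothesis upper : forall x, (word_length SG (i x) <= L * word_length SH x)%N.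
Hypothesis lower : forall x, (word_length SH x <= K * word_length SG (i x) + K)%N.
Variable h : R -> R -> R.
Hypothesis morse : morse_radius (vertex SG 1%g : cayley R SG) h.

(* The paths replacing the edges of [p] are padded by repetitions of their last
   vertices, so that all of them have length exactly [L]. *)
Lemma subdivided_path (p : nat -> H) : (forall k, adjeq SH (p k) (p k.+1)) ->
  exists2 u : nat -> G, forall k, adjeq SG (u k) (u k.+1) &
    forall k, u (k * L)%N = i (p k).
Proof.
move=> pS.
have /choice[q Hq] : forall k, exists q : nat -> G,
    [/\ forall m, adjeq SG (q m) (q m.+1), q 0%N = i (p k) & q L = i (p k.+1)].
  move=> k; have [q [qS q0 _ qL]] := word_path SG (i (p k)) (i (p k.+1)).
  exists q; split=> //; apply: qL; rewrite -morphVM; apply: leq_trans (upper _) _.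
  by rewrite -[leqRHS]muln1 leq_mul2l; apply/orP; right; apply/adjeqP.
exists (fun m => q (m %/ L)%N (m %% L)%N); last first.
  by move=> k; rewrite mulnK // modnMl; case: (Hq k).
move=> m; have mL := ltn_pmod m L0; rewrite (divn_eq m L).
move: (m %/ L)%N (m %% L)%N mL => k r rL.
have [qS q0 qL] := Hq k; have [_ q0' _] := Hq k.+1.
rewrite divnMDl // modnMDl (divn_small rL) (modn_small rL) addn0.
have [rL'|] := ltnP r.+1 L.
  by rewrite -addnS divnMDl // modnMDl (divn_small rL') (modn_small rL') addn0.
move=> Lr; have {Lr}rL' : r.+1 = L by apply/eqP; rewrite eqn_leq rL.
by rewrite -addnS rL' -mulSnr mulnK // modnMl q0' -qL -rL'.
Qed.

(** Each edge of [p] takes time [L], and [lower] divides by [K], whence the factor [L * K]. Rounding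
    [s] and [t] to multiples of [L] costs [2 * L]; the additive term of [lower] and the rounding in
    the quotient cost 1 each. *)
Lemma subdivided_quasi_geodesic (p : nat -> H) n (u : nat -> G)
    (uS : forall k, adjeq SG (u k) (u k.+1)) :
  (forall j k, (j <= k)%N -> (k <= n)%N -> word_length SH ((p j)^-1 * p k)%g = (k - j)%N) ->
  (forall k, u (k * L)%N = i (p k)) ->
  quasi_geodesic (L * K)%:R (2 + 2 * L%:R) `[0, (n * L)%:R] (edge_path R uS).
Proof.
move=> pg uL.
have l1 : 1 <= L%:R :> R by rewrite ler1n.
have k1 : 1 <= K%:R :> R by rewrite ler1n.
have lk1 : 1 <= (L * K)%:R :> R by rewrite ler1n muln_gt0 L0.
have lk0 : 0 < (L * K)%:R :> R by apply: lt_le_trans lk1.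
split=> //.
  apply: (@lipschitz_within_continuous _ _ _ 1) => // s t /=.
  rewrite !in_itv /= => /andP[s0 _] /andP[t0 _]; rewrite mul1r.
  exact: edge_path_lipschitz_norm.
suff Hst s t : 0 <= s -> s <= t -> t <= (n * L)%:R ->
    (t - s) / (L * K)%:R - (2 + 2 * L%:R) <= mdist (edge_path R uS s) (edge_path R uS t)
      <= (L * K)%:R * (t - s) + (2 + 2 * L%:R).
  move=> s t /=; rewrite !in_itv /= => /andP[s0 sn] /andP[t0 tn].
  have [st|/ltW ts] := lerP s t; first exact: Hst.
  by rewrite metric_sym; apply: Hst.
move=> s0 st tn; have t0 := le_trans s0 st; apply/andP; split; last first.
  apply: le_trans (edge_path_lipschitz uS s0 st) _.
  have : (t - s) <= (L * K)%:R * (t - s) by rewrite ler_peMl // subr_ge0.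
  lra.
have lL : 0 < L%:R :> R by lra.
have sL0 : 0 <= s / L%:R by apply: divr_ge0 => //; lra.
have tL0 : 0 <= t / L%:R by apply: divr_ge0 => //; lra.
have jk : (Num.truncn (s / L%:R) <= Num.truncn (t / L%:R))%N.
  by apply: le_truncn; rewrite ler_pM2r ?invr_gt0.
have /andP[js sj] := truncn_itv sL0; have /andP[kt tk] := truncn_itv tL0.
have kn : (Num.truncn (t / L%:R) <= n)%N.
  rewrite -(ler_nat R); apply: le_trans kt _.
  by rewrite ler_pdivrMr // -natrM.
move: (Num.truncn (s / L%:R)) (Num.truncn (t / L%:R)) jk js sj kt tk kn => j k jk.
rewrite ler_pdivlMr // ltr_pdivrMr // ler_pdivlMr // ltr_pdivrMr // -!natr1.
rewrite !mulrDl !mul1r => js sj kt tk kn.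
have H1 := edge_path_lipschitz uS (mulr_ge0 (ler0n _ _) (ltW lL)) js.
have H2 := edge_path_lipschitz uS (mulr_ge0 (ler0n _ _) (ltW lL)) kt.
rewrite -!natrM !edge_path_nat !uL in H1 H2.
have H3 : (k - j)%:R / K%:R - 1 <=
    mdist (vertex SG (i (p j)) : cayley R SG) (vertex SG (i (p k))).
  rewrite mdist_vertex -morphVM lerBlDr ler_pdivrMr; last by lra.
  rewrite -pg // mulrDl mul1r -natrM -natrD ler_nat mulnC; exact: lower.
have H4 := metric_triangle (vertex SG (i (p j))) (edge_path R uS s) (vertex SG (i (p k))).
have H5 := metric_triangle (edge_path R uS s) (edge_path R uS t) (vertex SG (i (p k))).
rewrite (metric_sym (edge_path R uS t) (vertex _ _)) in H5.
have H6 : (t - s) / (L * K)%:R <= (k - j)%:R / K%:R + 1.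
  have k0 : 0 < K%:R :> R by lra.
  rewrite natrM ler_pdivrMr ?mulr_gt0 // mulrDl mul1r (mulrC L%:R) mulrA.
  rewrite divfK ?gt_eqF // natrB // mulrBl.
  have : L%:R <= K%:R * L%:R :> R by rewrite ler_peMl // ltW.
  lra.
rewrite !natrM in js sj kt tk H1 H2; lra.
Qed.

(** The image of the [H]-geodesic through [z] is a quasi-geodesic, so the Morse lemma puts [i z]
    near a geodesic from [i x] to [i y]; a Gromov product is at most the distance from its base
    point to such a geodesic. *)
Lemma between_embedding : exists2 C : R, 0 <= C & forall x z y : H,
  (word_length SH (x^-1 * z)%g + word_length SH (z^-1 * y)%g)%N
    = word_length SH (x^-1 * y)%g ->
  gromov_product (vertex SG (i z) : cayley R SG) (vertex SG (i x)) (vertex SG (i y)) <= C.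
Proof.
exists (`|h (L * K)%:R (2 + 2 * L%:R)| + 1); first by rewrite addr_ge0.
move=> x z y xzy; have [p [pS p0 pz py]] := word_path_through xzy.
have [u uS uL] := subdivided_path pS.
set n := word_length SH (x^-1 * y)%g in py xzy.
have pg j k : (j <= k)%N -> (k <= n)%N -> word_length SH ((p j)^-1 * p k)%g = (k - j)%N.
  by apply: word_path_geodesic pS _; rewrite p0 py.
have qg := subdivided_quasi_geodesic uS pg uL.
have [v [vS v0 vm _]] := word_path SG (i x) (i y).
set m := word_length SG _ in vm.
have gv : geodesic `[0, m%:R] (edge_path R vS).
  by apply: edge_path_geodesic; rewrite v0 vm mdist_vertex.
have pv0 : edge_path R vS 0 = vertex SG (i x) by rewrite -v0 -(edge_path_nat R vS 0%N).
have [mo _] := morse.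
have Ji : is_interval (`[0, m%:R]%classic : set R) by apply: interval_is_interval.
have pu0 : edge_path R uS 0 = vertex SG (i x).
  by rewrite -p0 -(uL 0%N) mul0n -(edge_path_nat R uS 0%N).
have mz : nbhd (edge_path R vS @` `[0, m%:R]) (h (L * K)%:R (2 + 2 * L%:R))
    (vertex SG (i z)).
  apply: (mo _ _ _ _ 0 _ _ Ji gv (ler0n _ _) qg).
  - by exists 0; rewrite ?pv0 ?pu0 //= in_itv /= lexx ler0n.
  - by exists m%:R; rewrite ?edge_path_nat ?vm ?uL ?py //= in_itv /= lexx ler0n.
  - exists (word_length SH (x^-1 * z)%g * L)%:R; last by rewrite edge_path_nat uL pz.
    by rewrite /= in_itv /= ler0n ler_nat leq_mul2r -xzy leq_addr orbT.
have ne : edge_path R vS @` `[0, m%:R] !=set0.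
  by exists (edge_path R vS 0), 0 => //=; rewrite in_itv /= lexx ler0n.
have [_ [t tm <-] zt] := nbhdP ne mz ltr01.
have I0 : `[0, m%:R]%classic (0 : R) by rewrite /= in_itv /= lexx ler0n.
have Im : `[0, m%:R]%classic (m%:R : R) by rewrite /= in_itv /= lexx ler0n.
have H1 := gv _ _ I0 tm; have H2 := gv _ _ tm Im.
move: tm; rewrite /= in_itv /= => /andP[t0 tm].
rewrite pv0 sub0r normrN ger0_norm // in H1.
rewrite edge_path_nat vm distrC ger0_norm ?subr_ge0 // in H2.
have H3 := metric_triangle (vertex SG (i x)) (edge_path R vS t) (vertex SG (i z)).
have H4 := metric_triangle (vertex SG (i z)) (edge_path R vS t) (vertex SG (i y)).
have H5 := mdist_vertex R SG (i x) (i y); rewrite -/m in H5.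
rewrite /gromov_product (metric_sym (vertex SG (i y))).
rewrite (metric_sym (edge_path R vS t) (vertex SG (i z))) in H3.
have := ler_norm (h (L * K)%:R (2 + 2 * L%:R)); lra.
Qed.

End QuasiIsometricEmbedding.

(** * Linear comparison of Gromov products in [H] and in [G] *)

Section GromovProductComparison.
Variables (R : realType) (H G : groupType) (SH : fin_gen_set H) (SG : fin_gen_set G).
Variable i : H -> G.
Hypothesis iM : forall x y, i (x * y)%g = (i x * i y)%g.
Variables (deltaH deltaG : R) (K L : nat) (C0 : R).
Hypotheses (deltaH_ge0 : 0 <= deltaH) (deltaG_ge0 : 0 <= deltaG).
Hypotheses (hypH : gromov_hyperbolic (cayley R SH) deltaH)
           (hypG : gromov_hyperbolic (cayley R SG) deltaG).
Hypothesis K0 : (0 < K)%N.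
Hypothesis upper : forall x, (word_length SG (i x) <= L * word_length SH x)%N.
Hypothesis lower : forall x, (word_length SH x <= K * word_length SG (i x) + K)%N.
Hypothesis C0_ge0 : 0 <= C0.
Hypothesis between : forall x z y : H,
  (word_length SH (x^-1 * z)%g + word_length SH (z^-1 * y)%g)%N
    = word_length SH (x^-1 * y)%g ->
  gromov_product (vertex SG (i z) : cayley R SG) (vertex SG (i x)) (vertex SG (i y)) <= C0.

Let vH x : cayley R SH := vertex SH x.
Let vG x : cayley R SG := vertex SG (i x).

Let dG_le x y : mdist (vG x) (vG y) <= L%:R * mdist (vH x) (vH y).
Proof.
by rewrite !mdist_vertex -(morphVM iM) -natrM ler_nat.
Qed.

Let dG_ge x y : mdist (vH x) (vH y) <= K%:R * mdist (vG x) (vG y) + K%:R.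
Proof.
by rewrite !mdist_vertex -(morphVM iM) -natrM -natrD ler_nat.
Qed.

Let between_dist x y k : (k%:R <= mdist (vH x) (vH y)) ->
  exists z, [/\ mdist (vH x) (vH z) = k%:R,
    mdist (vH z) (vH y) = mdist (vH x) (vH y) - k%:R &
    gromov_product (vG z) (vG x) (vG y) <= C0].
Proof.
rewrite mdist_vertex ler_nat => /word_length_between[z zk zy].
exists z; rewrite !mdist_vertex zk; split=> //; last exact: between.
by rewrite -zy zk natrD addrAC subrr add0r.
Qed.

(** The point [z] at distance about [(1 | y)_x] from [x] on an [H]-geodesic to [y] is nearly the
    projection of 1, and its distance to 1 is at most [(x | y)_1] plus a constant. In [G] the
    product based at [i z] is at most [C0], and moving the base point to 1 costs at most [L] times
    that distance. *)
Lemma gromov_product_upper : exists2 C : R, 0 <= C & forall x y,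
  gromov_product (vG 1%g) (vG x) (vG y)
    <= C * gromov_product (vH 1%g) (vH x) (vH y) + C.
Proof.
have d0 := deltaH_ge0; have c0 := C0_ge0; have l0 : 0 <= L%:R :> R by [].
have A0 : 0 <= L%:R * (1 + 2 * deltaH) by rewrite mulr_ge0 // ; lra.
exists (L%:R * (1 + 2 * deltaH) + C0 + L%:R); first lra.
move=> x y; set g := gromov_product (vH 1%g) _ _.
have g0 : 0 <= g by apply: gromov_product_ge0.
set a := gromov_product (vH x) (vH 1%g) (vH y).
have a0 : 0 <= a by apply: gromov_product_ge0.
have /andP[ka ak] := truncn_itv a0; rewrite -natr1 in ak.
set k := Num.truncn a in ka ak.
have [|z [xz zy zC]] := @between_dist x y k.
  apply: le_trans ka _; rewrite /a gromov_productC metric_sym.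
  exact: gromov_product_le_dist.
have zy_k : k%:R <= gromov_product (vH x) (vH z) (vH y).
  by rewrite /gromov_product zy (metric_sym (vH z)) (metric_sym (vH y)) xz; lra.
have y1_k : k%:R <= gromov_product (vH x) (vH y) (vH 1%g) by rewrite gromov_productC.
have z1 := gromov_product_trans hypH zy_k y1_k.
have d1z : mdist (vH 1%g) (vH z) <= g + 1 + 2 * deltaH.
  move: z1 ka ak; rewrite /g /a /gromov_product.
  rewrite (metric_sym (vH z) (vH x)) xz (metric_sym (vH z) (vH 1%g)).
  rewrite (metric_sym (vH y) (vH x)) (metric_sym (vH y) (vH 1%g)).
  by rewrite (metric_sym (vH x) (vH 1%g)); lra.
have := gromov_product_base (vG 1%g) (vG z) (vG x) (vG y).
have := dG_le 1%g z.
have : L%:R * mdist (vH 1%g) (vH z) <= L%:R * (g + 1 + 2 * deltaH) by apply: ler_wpM2l.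
have : 0 <= (L%:R * (1 + 2 * deltaH) + C0) * g by rewrite mulr_ge0 //; lra.
move: (L%:R : R) l0 A0 => l l0 A0.
rewrite !mulrDl !mulrDr !mulr1; lra.
Qed.

(** At time [m], the integer part of the product, the [H]-geodesics from 1 to [x] and [y] still
    fellow-travel, at [z] and [w]. The images of these points are close, so the distance in [G] from
    1 to [i z] bounds the product there from below up to a constant, and [lower] compares that
    distance with [m]. *)
Lemma gromov_product_lower : exists2 C : R, 0 <= C & forall x y,
  gromov_product (vH 1%g) (vH x) (vH y)
    <= C * gromov_product (vG 1%g) (vG x) (vG y) + C.
Proof.
have d0 := deltaH_ge0; have e0 := deltaG_ge0; have c0 := C0_ge0.
have l0 : 0 <= L%:R :> R by [].
have k0 : 1 <= K%:R :> R by rewrite ler1n.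
have A0 : 0 <= L%:R * (4 * deltaH) by rewrite mulr_ge0 // mulr_ge0.
pose B := L%:R * (4 * deltaH) + C0 + 2 * deltaG.
have B0 : 0 <= B by rewrite /B; lra.
exists (K%:R * (B + 2)); first by rewrite mulr_ge0 //; lra.
move=> x y; set g := gromov_product (vH 1%g) _ _.
have g0 : 0 <= g by apply: gromov_product_ge0.
have /andP[mg gm] := truncn_itv g0; rewrite -natr1 in gm.
set m := Num.truncn g in mg gm.
have [|z [oz zx zC]] := @between_dist 1%g x m.
  apply: le_trans mg _; rewrite metric_sym; exact: gromov_product_le_dist.
have [|w [ow wy wC]] := @between_dist 1%g y m.
  by apply: le_trans mg _; rewrite metric_sym /g gromov_productC; apply: gromov_product_le_dist.
have zx_m : m%:R <= gromov_product (vH 1%g) (vH z) (vH x).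
  by rewrite /gromov_product zx !(metric_sym _ (vH 1%g)) oz; lra.
have yw_m : m%:R <= gromov_product (vH 1%g) (vH y) (vH w).
  by rewrite /gromov_product (metric_sym (vH y) (vH w)) wy !(metric_sym _ (vH 1%g)) ow; lra.
have zw := gromov_product_trans4 d0 hypH zx_m mg yw_m.
have {}zw : mdist (vH z) (vH w) <= 4 * deltaH.
  by move: zw; rewrite /gromov_product !(metric_sym _ (vH 1%g)) oz ow; lra.
have gzw : mdist (vG z) (vG w) <= L%:R * (4 * deltaH).
  by apply: le_trans (dG_le _ _) _; apply: ler_wpM2l.
set d := mdist (vG 1%g) (vG z).
(* The products [(x | z)_1] and [(1 | x)_z] in [G] add up to [d], and the second is at most [C0].
   The three bounds are weakened to a common one for [gromov_product_trans4]. *)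
have H1 : d - L%:R * (4 * deltaH) - C0 <= gromov_product (vG 1%g) (vG x) (vG z).
  move: zC; rewrite /d /gromov_product !(metric_sym _ (vG 1%g)).
  by rewrite (metric_sym (vG x) (vG z)); lra.
have dw := metric_triangle (vG 1%g) (vG w) (vG z).
rewrite (metric_sym (vG w)) -/d in dw.
have H2 : d - L%:R * (4 * deltaH) - C0 <= gromov_product (vG 1%g) (vG z) (vG w).
  by rewrite /gromov_product !(metric_sym _ (vG 1%g)) -/d; lra.
have H3 : d - L%:R * (4 * deltaH) - C0 <= gromov_product (vG 1%g) (vG w) (vG y).
  move: wC; rewrite /gromov_product !(metric_sym _ (vG 1%g)).
  by rewrite (metric_sym (vG y) (vG w)); lra.
have := gromov_product_trans4 e0 hypG H1 H2 H3.
set gg := gromov_product (vG 1%g) (vG x) (vG y) => H4.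
have dB : d <= gg + B by rewrite /B; lra.
have : K%:R * d <= K%:R * (gg + B) by apply: ler_wpM2l => //; lra.
have := dG_ge 1%g z; rewrite oz -/d.
have gg0 : 0 <= gg by apply: gromov_product_ge0.
have : 0 <= K%:R * (B + 1) * gg by apply: mulr_ge0 => //; apply: mulr_ge0 => //; lra.
move: (K%:R : R) k0 => k k0; clearbody B gg; lra.
Qed.

End GromovProductComparison.

(** * From injectivity to quasiconvexity *)

Lemma infinite_pigeonhole (T : eqType) (A : seq T) (P : T -> nat -> Prop) :
  (forall m, exists n, (m <= n)%N /\ exists2 a, a \in A & P a n) ->
  exists a, forall m, exists2 n, (m <= n)%N & P a n.
Proof.
elim: A => [|a A IH] PA; first by have [n [_ []]] := PA 0%N.
have [inf|/existsNP[m0 Hm0]] := pselect (forall m, exists2 n, (m <= n)%N & P a n).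
  by exists a.
apply: IH => m; have [n [mn [b]]] := PA (maxn m m0).
rewrite inE => /predU1P[->|bA] Pn.
  by case: Hm0; exists n => //; move: mn; lia.
by exists n; split; [lia|exists b].
Qed.

Section Konig.
Variables (H : groupType) (S : fin_gen_set H) (x : nat -> H).
Hypothesis x_infty : forall m, exists n0, forall n, (n0 <= n)%N ->
  (m <= word_length S (x n))%N.

(** That is, [g] lies on a geodesic from 1 to [x n]. *)
Let below g n := (word_length S g + word_length S (g^-1 * x n)%g)%N = word_length S (x n).
Let infinitely_below g := forall m, exists2 n, (m <= n)%N & below g n.

Let infinitely_below_next g : infinitely_below g ->
  exists s, [/\ adjeq S g s, word_length S s = (word_length S g).+1 & infinitely_below s].
Proof.
move=> gx; have [A HA] := letters_finite S.
have [|a Ha] := @infinite_pigeonhole _ A (fun a n =>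
  [/\ adjeq S g (g * a)%g, word_length S (g * a)%g = (word_length S g).+1 & below (g * a)%g n]).
  (* Beyond [n0] the element [x n] is longer than [g], so a further vertex exists. *)
  move=> m; have [n0 Hn0] := x_infty (word_length S g).+1.
  have [n] := gx (maxn m n0); rewrite geq_max => /andP[mn n0n] gn.
  exists n; split=> //; have gx1 := Hn0 n n0n; rewrite /below in gn.
  have [|z z1 zn] := @word_length_between _ S g (x n) 1; first by lia.
  exists (g^-1 * z)%g.
    apply: HA; have /adjeqP[gz|//] : (word_length S (g^-1 * z)%g <= 1)%N by rewrite z1.
    by move: z1; rewrite gz mulVg word_length1.
  rewrite mulVKg; have H1 := word_lengthM S g (g^-1 * z)%g; rewrite mulVKg in H1.
  have H2 := word_lengthM S z (z^-1 * x n)%g; rewrite mulVKg in H2.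
  split; rewrite /below; [by apply/adjeqP; rewrite z1|lia|lia].
have [n _ [ga gl _]] := Ha 0%N; exists (g * a)%g; split=> // m.
by have [k mk [_ _ ?]] := Ha m; exists k.
Qed.

(** Among the finitely many successors of a vertex below infinitely many [x n], one is again below
    infinitely many. The last clause stands in for a convergent subsequence. *)
Lemma konig_ray : exists v : nat -> H,
  [/\ forall k, adjeq S (v k) (v k.+1), forall k, word_length S (v k) = k, v 0%N = 1%g &
      forall k m, exists2 n, (m <= n)%N &
        (word_length S (v k) + word_length S ((v k)^-1 * x n)%g)%N = word_length S (x n)].
Proof.
have /choice[F HF] : forall g, exists s, infinitely_below g ->
    [/\ adjeq S g s, word_length S s = (word_length S g).+1 & infinitely_below s].
  move=> g; have [/infinitely_below_next[s]|ng] := pselect (infinitely_below g).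
    by exists s.
  by exists g => /ng.
have inf k : infinitely_below (iter k F 1%g).
  elim: k => [m|k IH]; last by case: (HF _ IH).
  by exists m => //; rewrite /below /= word_length1 invg1 mul1g.
exists (fun k => iter k F 1%g); split=> //.
- by move=> k; case: (HF _ (inf k)).
- elim=> [|k IH]; first by rewrite word_length1.
  by case: (HF _ (inf k)) => _ + _; rewrite IH.
Qed.

End Konig.

Section Quasiconvexity.
Variables (R : realType) (H G : groupType) (SH : fin_gen_set H) (SG : fin_gen_set G).
Variable i : H -> G.
Hypothesis iM : forall x y, i (x * y)%g = (i x * i y)%g.
Variables (deltaG : R) (deltaG_ge0 : 0 <= deltaG).
Hypothesis hypG : gromov_hyperbolic (cayley R SG) deltaG.

Let vG x : cayley R SG := vertex SG (i x).

(** Translation carries any vertex of an [H]-geodesic to 1, so [N] bounds the products based at all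
    of its vertices. A point of the [G]-geodesic is then compared with the vertex at about the same
    distance from [i x]. *)
Lemma quasiconvex_of_gromov_product (N : R) : (forall x y : H,
    (word_length SH x + word_length SH y)%N = word_length SH (x^-1 * y)%g ->
    gromov_product (vertex SG 1%g : cayley R SG) (vG x) (vG y) <= N) ->
  quasiconvex R (range i).
Proof.
move=> gN; have d0 := deltaG_ge0; exists SG.
have [L L0 upper] := word_length_lipschitz SH SG iM.
have N0 : 0 <= N.
  apply: le_trans (gN 1%g 1%g _); first exact: gromov_product_ge0.
  by rewrite invg1 mulg1 word_length1.
exists (2 * (L%:R + N + deltaG)); first by rewrite mulr_ge0 // !addr_ge0.
move=> a b gamma ab gg [_ [x _ <-] xa] [_ [y _ <-] yb] _ [s sab <-].
have Ia : `[a, b]%classic a by rewrite /= in_itv /= lexx.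
have Ib : `[a, b]%classic b by rewrite /= in_itv /= lexx ab.
have ds := gg _ _ Ia sab; have db := gg _ _ Ia Ib; have dsb := gg _ _ sab Ib.
move: sab; rewrite /= in_itv /= => /andP[as_ sb].
rewrite distrC ger0_norm ?subr_ge0 // -xa in ds.
rewrite distrC ger0_norm ?subr_ge0 // -xa -yb in db.
rewrite distrC ger0_norm ?subr_ge0 // -yb in dsb.
have [p [pS p0 pn _]] := word_path SH x y.
set n := word_length SH _ in pn.
(* Discrete intermediate value: the first vertex to reach distance [s - a - L] has not passed
   [s - a], because one step moves at most [L] in [G]. *)
have far : exists k, s - a - L%:R <= mdist (vG x) (vG (p k)).
  by exists n; rewrite pn db; have : 0 <= L%:R :> R by []; lra.
have [k sk kmin] := ex_minnP far.
have kn : (k <= n)%N.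
  by apply: kmin; rewrite pn db; have : 0 <= L%:R :> R by []; lra.
have ks : mdist (vG x) (vG (p k)) <= s - a.
  case: k sk kmin kn => [|k] sk kmin kn; first by rewrite p0 mdistxx subr_ge0.
  have : mdist (vG x) (vG (p k)) < s - a - L%:R.
    by rewrite ltNge; apply/negP => /kmin; rewrite ltnn.
  have : mdist (vG (p k)) (vG (p k.+1)) <= L%:R.
    rewrite mdist_vertex -(morphVM iM) ler_nat; apply: leq_trans (upper _) _.
    by rewrite -[leqRHS]muln1 leq_mul2l; apply/orP; right; apply/adjeqP.
  have := metric_triangle (vG x) (vG (p k)) (vG (p k.+1)); lra.
have pxy : gromov_product (vG (p k)) (vG x) (vG y) <= N.
  have e1 := word_path_geodesic pS _ (leq0n k) kn.
  have e2 := word_path_geodesic pS _ kn (leqnn n).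
  rewrite p0 pn -/n in e1 e2; have {}e1 := e1 erefl; have {}e2 := e2 erefl.
  have := gN ((p k)^-1 * x)%g ((p k)^-1 * y)%g.
  rewrite invgM invgK -mulgA mulVKg e2 (word_lengthC SH (p k) x) e1 subn0 subnKC //.
  move=> /(_ erefl).
  rewrite /gromov_product !mdist_vertex !(morphVM iM) !mulg1 !word_lengthV.
  by rewrite invgM invgK -mulgA mulVKg !(word_lengthC SG _ (i (p k))).
have gs : s - a <= gromov_product (vG x) (gamma s) (vG y).
  by rewrite /gromov_product (metric_sym (gamma s)) ds (metric_sym (vG y)) db dsb; lra.
(* The products [(y | p k)_x] and [(x | y)_(p k)] add up to the distance from [x] to [p k]. *)
have gp : s - a - L%:R - N <= gromov_product (vG x) (vG y) (vG (p k)).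
  move: pxy; rewrite /gromov_product (metric_sym (vG y) (vG x)).
  rewrite (metric_sym (vG (p k)) (vG x)).
  by move: sk; rewrite db; lra.
have gs' : s - a - L%:R - N <= gromov_product (vG x) (gamma s) (vG y).
  by apply: le_trans gs; have : 0 <= L%:R :> R by []; lra.
have := gromov_product_trans hypG gs' gp.
rewrite /gromov_product !(metric_sym _ (vG x)) ds => res.
apply: (@dist_set_le _ _ _ (vG (p k))); first by exists (i (p k)) => //; exists (p k).
lra.
Qed.

End Quasiconvexity.

Section InjectiveQuasiconvex.
Variables (R : realType) (H G : groupType) (SH : fin_gen_set H) (SG : fin_gen_set G).
Variable i : H -> G.
Hypothesis iM : forall x y, i (x * y)%g = (i x * i y)%g.
Variables (deltaH deltaG : R).
Hypotheses (deltaH_ge0 : 0 <= deltaH) (deltaG_ge0 : 0 <= deltaG).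
Hypotheses (hypH : gromov_hyperbolic (cayley R SH) deltaH)
           (hypG : gromov_hyperbolic (cayley R SG) deltaG).
Variables (repG : group_boundary R SG -> R -> cayley R SG)
          (repH : group_boundary R SH -> R -> cayley R SH).
Hypotheses (repGP : geodesic_representatives repG) (repHP : geodesic_representatives repH).
Variable di : group_boundary R SH -> group_boundary R SG.
Hypothesis diP : cannon_thurston i di.

Let eH : cayley R SH := vertex SH 1%g.
Let vH x : cayley R SH := vertex SH x.
Let vG x : cayley R SG := vertex SG (i x).

Let mdist_eH x : mdist (vH x) eH = (word_length SH x)%:R.
Proof. by rewrite mdist_vertex mulg1 word_lengthV. Qed.

Lemma word_ray_boundary (v : nat -> H) : (forall k, adjeq SH (v k) (v k.+1)) ->
  (forall k, word_length SH (v k) = k) -> v 0%N = 1%g ->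
  exists a : group_boundary R SH, forall M : R, exists T : nat, forall j t,
    (T <= j)%N -> T%:R <= t -> M <= gromov_product eH (vH (v j)) (repH a t).
Proof.
move=> vS vl v0.
have gv : geodesic_ray eH (edge_path R vS).
  rewrite /eH -v0; apply: edge_path_ray => n.
  by rewrite mdist_vertex v0 invg1 mul1g vl.
have [a av] := ray_boundary (geodesic_ray_quasi gv).
exists a => M; have [T T0 cvg] := gromov_product_rays_cvg M (repHP a).2 av (repHP a).1.
have /andP[_ /ltW TT] := truncn_itv T0.
exists (Num.truncn T).+1 => j t Tj Tt.
rewrite /vH -(edge_path_nat R vS); apply: cvg; apply: le_trans TT _ => //.
by rewrite ler_nat.
Qed.

Let gromov_product_below (v : nat -> H) x k j : (forall k, adjeq SH (v k) (v k.+1)) ->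
  (forall k, word_length SH (v k) = k) ->
  (word_length SH (v k) + word_length SH ((v k)^-1 * x)%g)%N = word_length SH x ->
  (k <= j)%N -> k%:R <= gromov_product eH (vH x) (vH (v j)).
Proof.
move=> vS vl vx kj; rewrite /gromov_product !mdist_eH mdist_vertex.
have := word_path_length vS kj.
have := word_lengthD SH (v k) x (v j); rewrite (word_lengthC SH x (v k)).
rewrite vl in vx; rewrite vl => H1 H2.
have : (word_length SH (x^-1 * v j)%g + k + k <= word_length SH x + j)%N by lia.
by rewrite -(ler_nat R) !natrD; lra.
Qed.

Lemma injective_quasiconvex : injective di -> quasiconvex R (range i).
Proof.
move=> inj; have [L L0 upper] := word_length_lipschitz SH SG iM.
have [[N gN]|noN] := pselect (exists N : R, forall x y : H,
    (word_length SH x + word_length SH y)%N = word_length SH (x^-1 * y)%g ->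
    gromov_product (vertex SG 1%g : cayley R SG) (vG x) (vG y) <= N).
  exact: (quasiconvex_of_gromov_product iM deltaG_ge0 hypG gN).
exfalso.
have /choice[xy Hxy] : forall n : nat, exists xy : H * H,
    (word_length SH xy.1 + word_length SH xy.2)%N = word_length SH (xy.1^-1 * xy.2)%g /\
    n%:R <= gromov_product (vertex SG 1%g : cayley R SG) (vG xy.1) (vG xy.2).
  move=> n; apply: contrapT => /forallNP nxy; apply: noN; exists n%:R => x y xy.
  rewrite leNgt; apply/negP => /ltW gn; exact: (nxy (x, y)).
have infty (f : nat -> H) : (forall n, n%:R <= mdist (vG (f n)) (vertex SG 1%g)) ->
    forall m, exists n0, forall n, (n0 <= n)%N -> (m <= word_length SH (f n))%N.
  move=> fn m; exists (L * m)%N => n Ln.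
  have := fn n; rewrite mdist_vertex mulg1 word_lengthV ler_nat => nf.
  have := leq_trans Ln (leq_trans nf (upper _)); rewrite leq_mul2l.
  by case: (L) L0 => // ? _.
have x_n n : n%:R <= mdist (vG (xy n).1) (vertex SG 1%g).
  by apply: le_trans (Hxy n).2 _; apply: gromov_product_le_dist.
have [v [vS vl v0 vx]] := konig_ray (infty _ x_n).
(* Indices adapted to [v]; the second use of Konig's lemma is made along them, so that both rays are
   followed simultaneously. *)
have /choice[phi Hphi] : forall k, exists n, (k <= n)%N /\
    (word_length SH (v k) + word_length SH ((v k)^-1 * (xy n).1)%g)%N
      = word_length SH (xy n).1.
  by move=> k; have [n kn vn] := vx k k; exists n.
have y_n n : n%:R <= mdist (vG (xy (phi n)).2) (vertex SG 1%g).
  apply: (@le_trans _ _ (phi n)%:R); first by rewrite ler_nat; case: (Hphi n).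
  apply: le_trans (Hxy (phi n)).2 _; rewrite gromov_productC.
  exact: gromov_product_le_dist.
have [w [wS wl w0 wy]] := konig_ray (infty (fun n => (xy (phi n)).2) y_n).
have below k m : exists n, [/\ (k <= n)%N, (m <= n)%N,
    (word_length SH (v k) + word_length SH ((v k)^-1 * (xy n).1)%g)%N
      = word_length SH (xy n).1 &
    (word_length SH (w k) + word_length SH ((w k)^-1 * (xy n).2)%g)%N
      = word_length SH (xy n).2].
  have [n kn wn] := wy k (maxn k m); have [pn vn] := Hphi n.
  move: kn; rewrite geq_max => /andP[kn mn].
  exists (phi n); split=> //; [exact: leq_trans pn|exact: leq_trans pn|].
  (* A geodesic to the point through [v n] may be taken through the earlier vertex [v k]. *)
  have := word_path_length vS kn.
  have := word_lengthD SH (v n) (v k) (xy (phi n)).1.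
  have := word_lengthM SH (v k) ((v k)^-1 * (xy (phi n)).1)%g; rewrite mulVKg.
  by move: vn; rewrite !vl; lia.
have [a va] := word_ray_boundary vS vl v0; have [b wb] := word_ray_boundary wS wl w0.
(* As 1 lies on a geodesic between the two points, the rays leave in opposite directions: [v T] and
   [w T] are at least [2 * T] apart, so their product cannot reach 1. *)
have ab : a <> b.
  move=> ab; have [T1 H1] := va (1 + deltaH); have [T2 H2] := wb (1 + deltaH).
  pose T := maxn T1 T2.
  have TT1 : (T1 <= T)%N by rewrite leq_maxl.
  have TT2 : (T2 <= T)%N by rewrite leq_maxr.
  have g1 := H1 T T%:R TT1; have g2 := H2 T T%:R TT2; rewrite !ler_nat -ab in g1 g2.
  have g2' := g2 TT2; rewrite gromov_productC in g2'.
  have := gromov_product_trans hypH (g1 TT1) g2'.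
  have [n [_ _ vn wn]] := below T 0%N; have [xyn _] := Hxy n.
  rewrite /gromov_product !mdist_eH mdist_vertex !vl !wl.
  have D1 := word_lengthD SH (v T) (xy n).1 (xy n).2.
  have D2 := word_lengthD SH (w T) (v T) (xy n).2.
  rewrite (word_lengthC SH (xy n).1 (v T)) in D1; rewrite !vl !wl in vn wn.
  have : (T + T <= word_length SH ((v T)^-1 * w T)%g)%N by lia.
  by rewrite -(ler_nat R) natrD; lra.
apply: ab; apply: inj.
apply: (boundary_eq_gromov_product deltaG_ge0 hypG (repGP _).2 (repGP _).2
  (repGP _).1 (repGP _).1) => N.
pose N' := N + 2 * deltaG.
have [Ma Ha] := cannon_thurston_product deltaG_ge0 hypG repGP repHP diP a N'.
have [Mb Hb] := cannon_thurston_product deltaG_ge0 hypG repGP repHP diP b N'.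
have nat_ge (r : R) : exists n : nat, r <= n%:R.
  by exists (Num.truncn r).+1; apply/ltW/truncnS_gt.
have [k Hk] := nat_ge (Num.max (Ma + deltaH) (Mb + deltaH)); have [m Hm] := nat_ge N'.
move: Hk; rewrite ge_max => /andP[ka kb].
have [n [kn mn vn wn]] := below k m.
have [T1 H1] := va (Ma + deltaH); have [T2 H2] := wb (Mb + deltaH).
(* With [v k] on a geodesic to the first point, the products of that point with later vertices of
   [v] are at least [k]; so it is close enough to [a] for [Ha], and likewise the second point to [b]
   for [Hb]. *)
have [T1' H1'] : exists T', forall t, T' <= t ->
    N' <= gromov_product (vertex SG 1%g) (vG (xy n).1) (repG (di a) t).
  apply: (Ha _ T1%:R) => t Tt; rewrite -[Ma](addrK deltaH).
  apply: (gromov_product_trans hypH (y := vH (v (maxn k T1)))).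
    by apply: le_trans ka _; apply: gromov_product_below => //; rewrite leq_maxl.
  by apply: H1 => //; rewrite leq_maxr.
have [T2' H2'] : exists T', forall t, T' <= t ->
    N' <= gromov_product (vertex SG 1%g) (vG (xy n).2) (repG (di b) t).
  apply: (Hb _ T2%:R) => t Tt; rewrite -[Mb](addrK deltaH).
  apply: (gromov_product_trans hypH (y := vH (w (maxn k T2)))).
    by apply: le_trans kb _; apply: gromov_product_below => //; rewrite leq_maxl.
  by apply: H2 => //; rewrite leq_maxr.
pose t := Num.max 0 (Num.max T1' T2').
have [t0 t1 t2] : [/\ 0 <= t, T1' <= t & T2' <= t].
  by rewrite /t !le_max !lexx !orbT.
exists t, t; split=> //; rewrite -[N](addrK (2 * deltaG)) -/N'.
(* The large product in [G] of the two group elements links the two image points. *)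
apply: (gromov_product_trans4 deltaG_ge0 hypG (y := vG (xy n).1) (z := vG (xy n).2)).
- by rewrite gromov_productC; apply: H1'.
- apply: le_trans (Hxy n).2; apply: le_trans Hm _; by rewrite ler_nat.
- exact: H2'.
Qed.

End InjectiveQuasiconvex.

(** * Bi-Lipschitz boundary maps *)

Section BoundaryComparison.
Variables (R : realType) (H G : groupType) (SH : fin_gen_set H) (SG : fin_gen_set G).
Variable i : H -> G.
Variable deltaG : R.
Hypothesis deltaG_ge0 : 0 <= deltaG.
Hypothesis hypG : gromov_hyperbolic (cayley R SG) deltaG.
Variables (repG : group_boundary R SG -> R -> cayley R SG)
          (repH : group_boundary R SH -> R -> cayley R SH).
Hypotheses (repGP : geodesic_representatives repG) (repHP : geodesic_representatives repH).
Variable di : group_boundary R SH -> group_boundary R SG.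
Hypothesis diP : cannon_thurston i di.

Let eH : cayley R SH := vertex SH 1%g.
Let eG : cayley R SG := vertex SG 1%g.
Let vH x : cayley R SH := vertex SH x.
Let vG x : cayley R SG := vertex SG (i x).

Let converges_at a N : exists n0 : R, forall n x, n0 <= n ->
  mdist (repH a n) (vH x) <= 1 ->
  exists T, forall t, T <= t -> N <= gromov_product eG (vG x) (repG (di a) t).
Proof.
have [M HM] := cannon_thurston_product deltaG_ge0 hypG repGP repHP diP a N.
exists (`|M| + 1) => n x Mn nx; apply: (HM x n) => t nt.
have n0 : 0 <= n by apply: le_trans Mn; rewrite addr_ge0.
have := gromov_product_near eH (repH a n) (vH x) (repH a t).
rewrite (gromov_product_ray (repHP a).1 n0 nt).
by have := ler_norm M; rewrite /eH; lra.
Qed.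

(** Vertices next to the rays at a late time have images close to the image points, but only up to
    the prescribed level [N]. The parameter [s] keeps that time late enough for monotonicity. *)
Lemma boundary_approx a b N (s : R) : exists n x y (T : R), [/\ s <= n, 0 <= n, 0 <= T &
  [/\ mdist (repH a n) (vH x) <= 1, mdist (repH b n) (vH y) <= 1 &
    forall t, T <= t -> N <= gromov_product eG (vG x) (repG (di a) t) /\
                        N <= gromov_product eG (vG y) (repG (di b) t)]].
Proof.
have [na Ha] := converges_at a N; have [nb Hb] := converges_at b N.
pose n := Num.max 0 (Num.max s (Num.max na nb)).
have [n0 sn nan nbn] : [/\ 0 <= n, s <= n, na <= n & nb <= n].
  by rewrite /n !le_max !lexx !orbT.
have [x xn] := near_vertex (repH a n); have [y yn] := near_vertex (repH b n).
have [Ta HTa] := Ha n x nan xn; have [Tb HTb] := Hb n y nbn yn.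
exists n, x, y, (Num.max 0 (Num.max Ta Tb)); split=> //; first by rewrite le_max lexx.
by split=> // t; rewrite !ge_max => /and3P[_ ta tb]; split; [apply: HTa|apply: HTb].
Qed.

Variables (C1 C2 : R).
Hypotheses (C1_ge0 : 0 <= C1) (C2_ge0 : 0 <= C2).
Hypothesis upper : forall x y,
  gromov_product eG (vG x) (vG y) <= C1 * gromov_product eH (vH x) (vH y) + C1.
Hypothesis lower : forall x y,
  gromov_product eH (vH x) (vH y) <= C2 * gromov_product eG (vG x) (vG y) + C2.

Let near2 (a b : group_boundary R SH) n x y :
  mdist (repH a n) (vH x) <= 1 -> mdist (repH b n) (vH y) <= 1 ->
  `|gromov_product eH (repH a n) (repH b n) - gromov_product eH (vH x) (vH y)| <= 2.
Proof.
move=> ax yb; rewrite ler_norml.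
have H1 := gromov_product_near eH (repH a n) (vH x) (repH b n).
have H2 := gromov_product_near eH (repH b n) (vH y) (vH x).
have H3 := gromov_product_near eH (vH x) (repH a n) (repH b n).
have H4 := gromov_product_near eH (vH y) (repH b n) (vH x).
rewrite !(gromov_productC eH (repH b n)) !(gromov_productC eH (vH y)) in H2 H4.
rewrite !(metric_sym (vH _)) in H3 H4.
by apply/andP; split; lra.
Qed.

Lemma boundary_product_lower a b N :
  (forall t, 0 <= t -> gromov_product eG (repG (di a) t) (repG (di b) t) <= N) ->
  forall s, 0 <= s ->
    gromov_product eH (repH a s) (repH b s) <= C2 * (N + 2 * deltaG) + C2 + 2.
Proof.
move=> gN s s0; have c2 := C2_ge0.
have [n [x [y [T [sn n0 T0 [ax yb HT]]]]]] := boundary_approx a b (N + 2 * deltaG + 1) s.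
have [xT yT] := HT T (lexx _).
have := near2 ax yb; rewrite ler_norml => /andP[_ nxy].
have sn' := gromov_product_rays_mono (repHP a).1 (repHP b).1 s0 sn.
have xy := lower x y.
have g_le : gromov_product eG (vG x) (vG y) <= N + 2 * deltaG.
  rewrite leNgt; apply/negP => Ng.
  (* The images are known to be near the boundary points only up to level [N + 2 * deltaG + 1], so
     their product is truncated there before chaining. *)
  pose m := Num.min (gromov_product eG (vG x) (vG y)) (N + 2 * deltaG + 1).
  have [m1 m2] : m <= gromov_product eG (vG x) (vG y) /\ m <= N + 2 * deltaG + 1.
    by rewrite /m !ge_min !lexx orbT.
  have mN : N + 2 * deltaG < m by rewrite /m lt_min Ng; lra.
  rewrite gromov_productC in xT.
  have := gromov_product_trans4 deltaG_ge0 hypG (le_trans m2 xT) m1 (le_trans m2 yT).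
  have := gN T T0; rewrite /eG; lra.
have : C2 * gromov_product eG (vG x) (vG y) <= C2 * (N + 2 * deltaG) by apply: ler_wpM2l.
rewrite /eH in sn' nxy xy *; lra.
Qed.

Lemma boundary_product_upper a b N :
  (forall s, 0 <= s -> gromov_product eH (repH a s) (repH b s) <= N) ->
  forall t, 0 <= t ->
    gromov_product eG (repG (di a) t) (repG (di b) t) <= C1 * (N + 2) + C1 + 2 * deltaG.
Proof.
move=> gN t t0; have c1 := C1_ge0.
set g := gromov_product _ _ _.
(* The level of approximation is the very product [g] to be bounded, so nothing is truncated. *)
have [n [x [y [T [_ n0 T0 [ax yb HT]]]]]] := boundary_approx a b g 0.
have tT : T <= Num.max t T by rewrite le_max lexx orbT.
have [xT yT] := HT _ tT.
have := near2 ax yb; rewrite ler_norml => /andP[nxy _].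
have gT : g <= gromov_product eG (repG (di a) (Num.max t T)) (repG (di b) (Num.max t T)).
  by apply: (gromov_product_rays_mono (repGP _).1 (repGP _).1) => //; rewrite le_max lexx.
rewrite (gromov_productC _ (vG y)) in yT.
have := gromov_product_trans4 deltaG_ge0 hypG xT gT yT.
have := upper x y; have := gN n n0.
have : C1 * gromov_product eH (vH x) (vH y) <= C1 * (N + 2).
  by apply: ler_wpM2l => //; have := gN n n0; lra.
lra.
Qed.

End BoundaryComparison.

Lemma bilipschitz_powR (R : realType) (A B : Type) (dA : A -> A -> R) (dB : B -> B -> R)
    (rhoA : A -> A -> R) (rhoB : B -> B -> R) (f : A -> B) (theta cA cB K : R) :
  0 <= theta -> 1 <= cA -> 1 <= cB -> 1 <= K ->
  (forall a b, 0 <= rhoA a b) -> (forall a b, 0 <= rhoB a b) ->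
  (forall a b, cA^-1 * (rhoA a b `^ theta) <= dA a b <= cA * (rhoA a b `^ theta)) ->
  (forall a b, cB^-1 * (rhoB a b `^ theta) <= dB a b <= cB * (rhoB a b `^ theta)) ->
  (forall a b, rhoA a b <= K * rhoB (f a) (f b)) ->
  (forall a b, rhoB (f a) (f b) <= K * rhoA a b) ->
  bilipschitz_onto_image dA dB f.
Proof.
move=> t0 a1 b1 k1 rA0 rB0 dAr dBr AB BA.
have Kt : 1 <= K `^ theta by rewrite -(powRr0 K) ler_powR.
have ca0 : 0 < cA by lra. have cb0 : 0 < cB by lra.
have L1 : 1 <= cA * cB * K `^ theta.
  by rewrite -[leLHS]mulr1 -{1}[1]mulr1 !ler_pM // ?mulr_ge0.
have pow r r' : 0 <= r -> 0 <= r' -> r <= K * r' -> r `^ theta <= K `^ theta * r' `^ theta.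
  move=> r0 r'0 rr'; rewrite -powRM //; last lra.
  by apply: ge0_ler_powR; rewrite ?nnegrE // mulr_ge0 //; lra.
exists (cA * cB * K `^ theta) => // a b.
have /andP[lA uA] := dAr a b; have /andP[lB uB] := dBr (f a) (f b).
rewrite ler_pdivrMl in lA => //; rewrite ler_pdivrMl in lB => //.
have L0 : 0 < cA * cB * K `^ theta by lra.
rewrite ler_pdivrMl //; apply/andP; split.
  apply: (le_trans uA); rewrite -!mulrA ler_pM2l // mulrCA.
  apply: le_trans (pow _ _ (rA0 _ _) (rB0 _ _) (AB a b)) _.
  by rewrite ler_pM2l //; lra.
apply: (le_trans uB); rewrite (mulrC cA) -!mulrA ler_pM2l // mulrCA.
apply: le_trans (pow _ _ (rB0 _ _) (rA0 _ _) (BA a b)) _.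
by rewrite ler_pM2l //; lra.
Qed.

(** * Comparison of the functions underlying the logarithmic metrics *)

Section Metrics.
Variables (R : realType) (H G : groupType) (SH : fin_gen_set H) (SG : fin_gen_set G).
Variable i : H -> G.
Hypotheses (iM : forall x y, i (x * y)%g = (i x * i y)%g) (i_inj : injective i).
Variables (deltaG deltaH : R).
Hypotheses (deltaG_ge0 : 0 <= deltaG) (deltaH_ge0 : 0 <= deltaH).
Hypotheses (hypG : gromov_hyperbolic (cayley R SG) deltaG)
           (hypH : gromov_hyperbolic (cayley R SH) deltaH).
Variable kappa : R -> R.
Hypothesis kappa_sublinear : sublinear kappa.
Variable h : R -> R -> R -> R.
Hypotheses (morseG : morse_radius (vertex SG 1%g : cayley R SG) (h deltaG))
           (morseH : morse_radius (vertex SH 1%g : cayley R SH) (h deltaH)).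
Variables (repG : group_boundary R SG -> R -> cayley R SG)
          (repH : group_boundary R SH -> R -> cayley R SH).
Hypotheses (repGP : geodesic_representatives repG) (repHP : geodesic_representatives repH).
Variable di : group_boundary R SH -> group_boundary R SG.
Hypothesis diP : cannon_thurston i di.

Lemma quasiconvex_log_rho : quasiconvex R (range i) ->
  exists2 K : R, 1 <= K & forall a b,
    log_rho kappa deltaH h repH a b <= K * log_rho kappa deltaG h repG (di a) (di b) /\
    log_rho kappa deltaG h repG (di a) (di b) <= K * log_rho kappa deltaH h repH a b.
Proof.
move=> /(quasiconvex_embedding SH SG iM i_inj)[K K0 low].
have [L L0 up] := word_length_lipschitz SH SG iM.
have [C0 C0_ge0 btw] := between_embedding iM K0 L0 up low morseG.
have [C1 C1_ge0 gup] := gromov_product_upper iM deltaH_ge0 hypH up C0_ge0 btw.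
have [C2 C2_ge0 glow] :=
  gromov_product_lower iM deltaH_ge0 deltaG_ge0 hypH hypG K0 up low C0_ge0 btw.
rewrite (morph1 iM) in gup glow.
have [rH HrH] := fellow_radius_gromov_product deltaH_ge0 hypH kappa_sublinear morseH repHP.
have [rG HrG] := fellow_radius_gromov_product deltaG_ge0 hypG kappa_sublinear morseG repGP.
(* Products at most [2 * r] in [H] give [r' <= max(rG, 4 * C1 * r + 6 * C1 + 4 * deltaG)], and
   similarly in the other direction; [K'] dominates all these constants. The further factor 6 is
   that of [log_rho_bounds]. *)
pose K' := 1 + `|rH| + `|rG| + 10 * (C1 + C2 + C2 * deltaG + deltaG + 1).
have c2d : 0 <= C2 * deltaG by rewrite mulr_ge0.
have d0 := deltaG_ge0.
have K'1 : 1 <= K'.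
  by rewrite /K'; have := normr_ge0 rH; have := normr_ge0 rG; lra.
exists (6 * K'); first lra.
move=> a b; have [->|ab] := pselect (a = b).
  by rewrite /log_rho !asboolT // mulr0.
have [r [rE r0 gr rN]] := HrH a b ab.
have gG := boundary_product_upper deltaG_ge0 hypG repGP repHP diP C1_ge0 gup gr.
(* For equal images the product at time [t] would be [t], hence unbounded, against [gG]. *)
have dab : di a <> di b.
  move=> dab; pose N := C1 * (2 * r + 2) + C1 + 2 * deltaG.
  have t0 : 0 <= `|N| + 1 by rewrite addr_ge0.
  have := gG _ t0; rewrite dab (gromov_product_ray (repGP _).1 t0 (lexx _)) -/N.
  by have := ler_norm N; lra.
have [r' [r'E r'0 gr' r'N]] := HrG _ _ dab.
have gH := boundary_product_lower deltaG_ge0 hypG repGP repHP diP C2_ge0 glow gr'.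
have up1 := r'N _ gG; have up2 := rN _ gH.
have /andP[l1 u1] := log_rho_bounds ab r0 rE.
have /andP[l2 u2] := log_rho_bounds dab r'0 r'E.
set x := log_rho _ _ _ _ _ _ in l1 u1 *; set y := log_rho _ _ _ _ _ _ in l2 u2 *.
have x0 : 0 <= x by apply: log_rho_ge0. have y0 : 0 <= y by apply: log_rho_ge0.
have nH := ler_norm rH; have nG := ler_norm rG.
have nH0 := normr_ge0 rH; have nG0 := normr_ge0 rG.
have C1r : 0 <= C1 * r by rewrite mulr_ge0. have C2r : 0 <= C2 * r' by rewrite mulr_ge0.
have hr : 1 + r <= K' * (1 + r').
  rewrite le_max in up2.
  have : 0 <= (`|rH| + `|rG| + 10 * (C1 + C2 * deltaG + deltaG + 1)) * r'.
    by rewrite mulr_ge0 //; lra.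
  by rewrite /K'; case/orP: up2; lra.
have hr' : 1 + r' <= K' * (1 + r).
  rewrite le_max in up1.
  have : 0 <= (`|rH| + `|rG| + 10 * (C2 + C2 * deltaG + deltaG + 1)) * r.
    by rewrite mulr_ge0 //; lra.
  by rewrite /K'; case/orP: up1; lra.
have r1 : 0 < 1 + r by lra. have r'1 : 0 < 1 + r' by lra.
split.
- rewrite -(ler_pM2r r1); apply: (le_trans u1).
  have : y * (1 + r') <= y * (K' * (1 + r)) by apply: ler_wpM2l.
  by lra.
- rewrite -(ler_pM2r r'1); apply: (le_trans u2).
  have : x * (1 + r) <= x * (K' * (1 + r')) by apply: ler_wpM2l.
  by lra.
Qed.

End Metrics.

Theorem corollary3 (R : realType)
    (G : groupType) (P : {pred G}) (H : subGroupType P)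
    (SG : fin_gen_set G) (SH : fin_gen_set H)
    (deltaG deltaH : R)
    (deltaG_ge0 : 0 <= deltaG) (deltaH_ge0 : 0 <= deltaH)
    (hypG : gromov_hyperbolic (cayley R SG) deltaG)
    (hypH : gromov_hyperbolic (cayley R SH) deltaH)
    (kappa : R -> R) (kappa_sublinear : sublinear kappa)
    (h : R -> R -> R -> R)
    (morseG : morse_radius (vertex SG 1%g : cayley R SG) (h deltaG))
    (morseH : morse_radius (vertex SH 1%g : cayley R SH) (h deltaH))
    (repG : group_boundary R SG -> R -> cayley R SG)
    (repH : group_boundary R SH -> R -> cayley R SH)
    (repGP : geodesic_representatives repG)
    (repHP : geodesic_representatives repH)
    (di : group_boundary R SH -> group_boundary R SG)
    (diP : cannon_thurston (val : H -> G) di)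
    (theta : R) (theta_adm : admissible_exponent theta)
    (dG : group_boundary R SG -> group_boundary R SG -> R)
    (dH : group_boundary R SH -> group_boundary R SH -> R)
    (dGP : log_metric kappa deltaG h repG theta dG)
    (dHP : log_metric kappa deltaH h repH theta dH) :
  (quasiconvex R [set g : G | g \in P] <-> bilipschitz_onto_image dH dG di) /\
  (bilipschitz_onto_image dH dG di <-> injective di).
Proof.
have iM (x y : H) : val (x * y)%g = (val x * val y)%g by apply: gmulfM.
have rangeP : range (val : H -> G) = [set g : G | g \in P].
  apply/seteqP; split=> [_ [x _ <-]|g gP]; first exact: valP.
  by exists (Sub g gP) => //; rewrite SubK.
have bilip_inj : bilipschitz_onto_image dH dG di -> injective di.
  move=> [L L1 dL] a b ab; have [dH0 dHeq _ _] := dHP.1; have [_ dGeq _ _] := dGP.1.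
  have /andP[+ _] := dL a b; rewrite ab (dGeq _ _).2 // ler_pdivrMl; last by lra.
  by rewrite mulr0 => dab; apply/dHeq/le_anti; rewrite dab dH0.
have inj_qc : injective di -> quasiconvex R [set g : G | g \in P].
  rewrite -rangeP; exact: (injective_quasiconvex iM deltaH_ge0 deltaG_ge0 hypH hypG
    repGP repHP diP).
have qc_bilip : quasiconvex R [set g : G | g \in P] -> bilipschitz_onto_image dH dG di.
  rewrite -rangeP => /(quasiconvex_log_rho iM val_inj deltaG_ge0 deltaH_ge0 hypG hypH
    kappa_sublinear morseG morseH repGP repHP diP) [K K1 HK].
  have [_ [cG cG1 dGr]] := dGP; have [_ [cH cH1 dHr]] := dHP.
  have /andP[/ltW theta0 _] := theta_adm.
  apply: (bilipschitz_powR theta0 cH1 cG1 K1 _ _ dHr dGr) => a b.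
  - exact: log_rho_ge0.
  - exact: log_rho_ge0.
  - by case: (HK a b).
  - by case: (HK a b).
by split; split; auto.
Qed.
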